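(* Suppose all the assumptions on the problem, the set $\mathcal{X}$, the Lagrange multiplier, the oracles and the initial point listed in the context hold, and let $x^*\in\mathcal{X}^*$. Run the algorithm described in the context with any $T\in\{1,2,3,\ldots\}$, $\eta>0$, $\alpha>0$, $\beta>0$ and $\delta\ge 0$, and let $\bar{x}_T$ be its output. Then $$\mathbb{E}\{f(\bar{x}_T)\}-f(x^* )\le \frac{L^2}{2T\eta}+\eta\,\frac{D^2+2\delta}{2}+\frac{L^2}{2\alpha}+\frac{\alpha D^2}{2T}+\frac{G^2D^2\beta}{T}.$$ In particular: (1) If $\epsilon>0$, $\eta=\epsilon$, $\alpha=\beta=1/\epsilon$, then $\mathbb{E}\{f(\bar{x}_T)\}-f^*\le \mathcal{O}(\epsilon)$ for all integers $T\ge 1/\epsilon^2$, where the constant hidden in $\mathcal{O}$ does not depend on $\epsilon$ or $T$. (2) If $L,G,D>0$ and $\alpha=\frac{L\sqrt{T}}{D}$, $\eta=\frac{L}{\sqrt{T(D^2+2\delta)}}$, $\beta=\frac{\sqrt{T}}{GD}$, then $$\mathbb{E}\{f(\bar{x}_T)\}-f^*\le \left(L\sqrt{D^2+2\delta}+LD+GD\right)\frac{1}{\sqrt{T}}.$$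
   Context: **Problem.** $\mathbb{V}$ is a finite-dimensional real inner product space with inner product $\langle\cdot,\cdot\rangle$ and norm $\|v\|=\sqrt{\langle v,v\rangle}$; $\|\cdot\|_2$ is the Euclidean norm on $\mathbb{R}^m$. $m$ is a nonnegative integer. $f:\mathbb{V}\to\mathbb{R}$ and $h_i:\mathbb{V}\to\mathbb{R}$ ($i=1,\ldots,m$) are convex continuous functions and $h=(h_1,\ldots,h_m)^\top$. The problem is to minimize $f(x)$ subject to $h_i(x)\le 0$ for all $i$ and $x\in\mathcal{X}$, where $\mathcal{X}\subseteq\mathbb{V}$. The set $\mathcal{X}^*\subseteq\mathcal{X}$ of optimal solutions is nonempty and $f^*$ is the optimal value. $[a]_+=\max\{0,a\}$, applied entrywise to vectors. $\partial$ denotes the subdifferential. **Assumptions.** 1. $\mathcal{X}$ is compact and convex, and $D$ is a known constant with $\|x-y\|\le D$ for all $x,y\in\mathcal{X}$. 2. There is a vector (Lagrange multiplier) $\mu\in\mathbb{R}^m$ with nonnegative entries such that $f^*\le f(x)+\mu^\top h(x)$ for all $x\in\mathcal{X}$. 3. The following oracles are available. (i) Inexact linear minimization oracle: given $v\in\mathbb{V}$ and $\delta\ge 0$, it returns a random point $x=\mathrm{InLMO}_{\mathcal{X}}\{v;\delta\}\in\mathcal{X}$ with $\mathbb{E}\{\langle x,v\rangle\}\le\langle y,v\rangle+\delta$ for all $y\in\mathcal{X}$ (for a random query $v$, the expectation is conditional on $v$). (ii) Projection oracle: there is a closed convex set $\mathcal{Y}\subseteq\mathbb{V}$ with $\mathcal{X}\subseteq\mathcal{Y}$;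 given $v\in\mathbb{V}$ it returns $\mathrm{PO}_{\mathcal{Y}}\{v\}=\arg\min_{y\in\mathcal{Y}}\|v-y\|$. (iii) Stochastic subgradient oracle: given $y\in\mathcal{Y}$ it independently returns random vectors $s,g_1,\ldots,g_m\in\mathbb{V}$ with $\mathbb{E}\{s\mid y\}\in\partial f(y)$ and $\mathbb{E}\{g_i\mid y\}\in\partial h_i(y)$ for all $i$. There are constants $L,G,G_1,\ldots,G_m\ge 0$ such that always $\|g_i\|\le G_i$, $\sum_{i=1}^m G_i^2\le G^2$, and $\sqrt{\mathbb{E}\{\|s\|^2\mid y\}}\le L$. Each call uses fresh randomness: conditionally on the query point $y$, the output is independent of everything generated by the algorithm before the call. (iv) Function value oracle: given $y\in\mathcal{Y}$, it returns $h_1(y),\ldots,h_m(y)$. 4. An initial point $x_1\in\mathcal{X}$ is available. **Algorithm** (parameters $T\in\{1,2,\ldots\}$, $\eta,\alpha,\beta>0$, $\delta\ge0$). Set $y_1=x_1$, $Q_1=0\in\mathbb{V}$, obtain stochastic subgradients $s_1,g_{1,1},\ldots,g_{m,1}$ at $y_1$, and set $W_1=[-h(y_1)]_+\in\mathbb{R}^m$. For $t=1,\ldots,T-1$: - $x_{t+1}=\mathrm{InLMO}_{\mathcal{X}}\{-Q_t;\delta\}$; - $p_t=\eta Q_t+s_t+\beta\sum_{i=1}^m (W_{i,t}+h_i(y_t))\,g_{i,t}$; - $\tilde{y}_{t+1}=\dfrac{(\alpha+2G^2\beta)y_t+\eta x_{t+1}-p_t}{\alpha+2G^2\beta+\eta}$;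 - $y_{t+1}=\mathrm{PO}_{\mathcal{Y}}\{\tilde{y}_{t+1}\}$; - $Q_{t+1}=Q_t+y_{t+1}-x_{t+1}$; - obtain stochastic subgradients $s_{t+1},g_{1,t+1},\ldots,g_{m,t+1}$ at $y_{t+1}$; - for each $i$, $W_{i,t+1}=\max\{W_{i,t}+h_i(y_t)+\langle g_{i,t},y_{t+1}-y_t\rangle,\ [-h_i(y_{t+1})]_+\}$. Output: $\bar{x}_T=\frac1T\sum_{t=1}^T x_t$. *)

(* Defs.v *)
From HB Require Import structures.
From mathcomp Require Import all_boot all_order all_algebra.
From mathcomp Require Import all_classical all_reals all_analysis.

Set Implicit Arguments.
Unset Strict Implicit.
Unset Printing Implicit Defensive.

Import Order.TTheory GRing.Theory Num.Theory.
Import numFieldNormedType.Exports.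

Local Open Scope classical_set_scope.
Local Open Scope ring_scope.

(* A finite-dimensional real inner product space: the norm of the normed
   module, hence its topology, is the one induced by the inner product. *)
HB.mixin Record NormedModule_isEuclidean (R : realType) (V : Type)
    of NormedModule R V & Vector R V := {
  inner : {dot V for @idfun R};
  norm_inner : forall v : V, `|v| = Num.sqrt (inner v v)
}.

#[short(type="euclideanType")]
HB.structure Definition Euclidean (R : realType) :=
  {V of NormedModule_isEuclidean R V & NormedModule R V & Vector R V}.

Notation "''[' u , v ]" := (inner u v) (format "''[' u ,  v ]") : ring_scope.

Notation borel V := (g_sigma_algebraType (@open V)).

Section ConvexProgram.
Context {R : realType} {V : euclideanType R} {m : nat}.

Definition subdifferential (f : V -> R) (x : V) : set V :=
  [set g | forall z, f x + '[g, z - x] <= f z].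

Definition feasible (h : 'I_m -> V -> R) (X : set V) : set V :=
  [set x | X x /\ forall i, h i x <= 0].

Definition optimal_solutions (f : V -> R) (h : 'I_m -> V -> R) (X : set V) :
    set V :=
  [set x | feasible h X x /\ forall z, feasible h X z -> f x <= f z].

Definition optimal_value (f : V -> R) (h : 'I_m -> V -> R) (X : set V) : R :=
  inf (f @` feasible h X).

Definition lagrange_multiplier (f : V -> R) (h : 'I_m -> V -> R) (X : set V)
    (mu : 'I_m -> R) : Prop :=
  (forall i, 0 <= mu i) /\
  forall x, X x -> optimal_value f h X <= f x + \sum_(i < m) mu i * h i x.

Definition is_projection (Y : set V) (v p : V) : Prop :=
  Y p /\ forall y, Y y -> `|v - p| <= `|v - y|.

End ConvexProgram.

Section Conditioning.
Context {d : measure_display} {Omega : measurableType d} {R : realType}.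
Variable P : probability Omega R.

(* Z is a version of the conditional expectation E[X | F]; F is meant to be a
   sub-sigma-algebra of the measurable sets. *)
Definition is_cond_exp (F : set (set Omega)) (X Z : Omega -> R) : Prop :=
  [/\ P.-integrable setT (EFin \o X),
      P.-integrable setT (EFin \o Z),
      forall B : set R, measurable B -> F (Z @^-1` B) &
      forall A, F A ->
        (\int[P]_(w in A) (X w)%:E = \int[P]_(w in A) (Z w)%:E)%E].

(* F1 and F2 are conditionally independent given C, that is
   P(A `&` B | C) = P(A | C) P(B | C) for all A in F1 and B in F2. *)
Definition cond_independent (F1 F2 C : set (set Omega)) : Prop :=
  forall A B, F1 A -> F2 B ->
    exists ZA ZB : Omega -> R,
      [/\ is_cond_exp C \1_A ZA, is_cond_exp C \1_B ZB &
          is_cond_exp C \1_(A `&` B) (fun w => ZA w * ZB w)].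

(* K (q w) is the law of the output r given the random query q. *)
Definition has_cond_law {dq dr} {TQ : measurableType dq}
    {TR : measurableType dr} (K : R.-pker TQ ~> TR)
    (q : Omega -> TQ) (r : Omega -> TR) : Prop :=
  forall B : set TR, measurable B ->
    is_cond_exp (g_sigma_algebra_preimage q) \1_(r @^-1` B)
      (fun w => fine (K (q w) B)).

(* r is the output of the oracle K called at q: given q it has law K q and is
   independent of the past. *)
Definition oracle_call {dq dr} {TQ : measurableType dq}
    {TR : measurableType dr} (K : R.-pker TQ ~> TR)
    (past : set (set Omega)) (q : Omega -> TQ) (r : Omega -> TR) : Prop :=
  has_cond_law K q r /\
  cond_independent (g_sigma_algebra_preimage r) past
    (g_sigma_algebra_preimage q).

End Conditioning.

Section Oracles.
Context {R : realType} {V : euclideanType R} {m : nat}.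

(* z is the expectation of the V-valued function X, read off its coordinates. *)
Definition is_mean {d} {T : measurableType d} (mu : {measure set T -> \bar R})
    (X : T -> V) (z : V) : Prop :=
  forall v : V,
    mu.-integrable setT (fun w => ('[X w, v])%:E) /\
    (\int[mu]_w ('[X w, v])%:E = ('[z, v])%:E)%E.

(* K y is the joint law of the output (s, (g_1, ..., g_m)) of the oracle at the
   query point y. *)
Definition stochastic_subgradient_oracle (f : V -> R) (h : 'I_m -> V -> R)
    (Y : set V) (L : R) (Gi : 'I_m -> R)
    (K : R.-pker (borel V) ~> (borel V * m.-tuple (borel V))%type) : Prop :=
  forall y : V, Y y ->
  [/\ exists2 z, is_mean (K y) (fun o => o.1 : V) z & subdifferential f y z,
      forall i, exists2 z,
        is_mean (K y) (fun o => tnth o.2 i : V) z & subdifferential (h i) y z,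
      forall i, {ae K y, forall o, `|tnth o.2 i : V| <= Gi i} &
      (sqrte (\int[K y]_o (`|o.1 : V| ^+ 2)%:E) <= L%:E)%E].

(* x is the answer of the inexact linear minimization oracle to the random
   query v. *)
Definition inexact_lmo_call {d} {Omega : measurableType d}
    (P : probability Omega R) (X : set V) (delta : R) (v x : Omega -> V) :
    Prop :=
  [/\ measurable_fun setT (x : Omega -> borel V),
      forall w, X (x w) &
      exists2 Z, is_cond_exp P (g_sigma_algebra_preimage (v : Omega -> borel V))
                   (fun w => '[x w, v w]) Z &
        forall y, X y -> {ae P, forall w, Z w <= '[y, v w] + delta}].

End Oracles.

Section Algorithm.
Context {R : realType} {V : euclideanType R} {m : nat}.

(* The variables of one execution; time starts at t = 1, the values at index 0
   are irrelevant. *)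
Record execution (Omega : Type) := Execution {
  xs : nat -> Omega -> V;
  ys : nat -> Omega -> V;
  Qs : nat -> Omega -> V;
  ss : nat -> Omega -> V;
  gs : nat -> 'I_m -> Omega -> V;
  Ws : nat -> 'I_m -> Omega -> R
}.

Definition positive_part (a : R) : R := Num.max 0 a.

Context {d : measure_display} {Omega : measurableType d}.

Definition sigma_generated (Xs : set (Omega -> V)) : set (set Omega) :=
  <<s \bigcup_(X in Xs) g_sigma_algebra_preimage (X : Omega -> borel V) >>.

(* What has been generated before the oracle is called at y_t. The other
   variables Q_1, ..., Q_t and W_1, ..., W_(t-1), and the intermediate ones,
   are functions of these. *)
Definition history (e : execution Omega) (t : nat) : set (set Omega) :=
  sigma_generated
    [set X | (exists2 k, (1 <= k <= t)%N & X = xs e k \/ X = ys e k) \/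
             (exists2 k, (1 <= k < t)%N &
                X = ss e k \/ exists i, X = gs e k i)].

Definition subgradient_output (e : execution Omega) (t : nat) (w : Omega) :
    borel V * m.-tuple (borel V) :=
  (ss e t w, [tuple gs e t i w | i < m]).

Variables (P : probability Omega R) (f : V -> R) (h : 'I_m -> V -> R).
Variables (X Y : set V) (x1 : V) (G : R).
(* The law of the oracle may vary with the number t of the call. *)
Variable K : nat -> R.-pker (borel V) ~> (borel V * m.-tuple (borel V))%type.

Definition direction (eta beta : R) (e : execution Omega) (t : nat)
    (w : Omega) : V :=
  eta *: Qs e t w + ss e t w
  + beta *: \sum_(i < m) (Ws e t i w + h i (ys e t w)) *: gs e t i w.

Definition ytilde (eta alpha beta : R) (e : execution Omega) (t : nat)
    (w : Omega) : V :=
  (alpha + 2 * G ^+ 2 * beta + eta)^-1 *: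
  ((alpha + 2 * G ^+ 2 * beta) *: ys e t w + eta *: xs e t.+1 w
   - direction eta beta e t w).

Record is_run (T : nat) (eta alpha beta delta : R) (e : execution Omega) :
    Prop := IsRun {
  init_x : forall w, xs e 1 w = x1;
  init_y : forall w, ys e 1 w = x1;
  init_Q : forall w, Qs e 1 w = 0;
  init_W : forall i w, Ws e 1 i w = positive_part (- h i (ys e 1 w));
  step_x : forall t, (1 <= t < T)%N ->
    inexact_lmo_call P X delta (fun w => - Qs e t w) (xs e t.+1);
  step_y : forall t w, (1 <= t < T)%N ->
    is_projection Y (ytilde eta alpha beta e t w) (ys e t.+1 w);
  step_Q : forall t w, (1 <= t < T)%N ->
    Qs e t.+1 w = Qs e t w + ys e t.+1 w - xs e t.+1 w;
  subgradient_measurable : forall t, (1 <= t <= T)%N ->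
    measurable_fun setT (subgradient_output e t);
  subgradient_call : forall t, (1 <= t <= T)%N ->
    oracle_call P (K t) (history e t) (ys e t : Omega -> borel V)
      (subgradient_output e t);
  step_W : forall t i w, (1 <= t < T)%N ->
    Ws e t.+1 i w =
      Num.max (Ws e t i w + h i (ys e t w)
                 + '[gs e t i w, ys e t.+1 w - ys e t w])
              (positive_part (- h i (ys e t.+1 w)))
}.

Definition output (T : nat) (e : execution Omega) (w : Omega) : V :=
  T%:R^-1 *: \sum_(1 <= t < T.+1) xs e t w.

End Algorithm.

Arguments execution {R} V m Omega.

(* Main.v *)
From HB Require Import structures.
Require Import Defs.
From mathcomp Require Import all_boot all_order all_algebra.
From mathcomp Require Import all_classical all_reals all_analysis.
From mathcomp Require Import measurable_realfun finmap ring lra.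
Import Order.TTheory GRing.Theory Num.Theory.
Import numFieldNormedType.Exports.
Set Implicit Arguments.
Unset Strict Implicit.
Unset Printing Implicit Defensive.
Local Open Scope classical_set_scope.
Local Open Scope ring_scope.

(** The proof is a drift-plus-penalty argument. Let u be an optimal point, put
    c = alpha + 2 G^2 beta, and attach to time t the potential
    [Phi_t = eta/2 |Q_t|^2
             + beta/2 sum_i (W_{i,t}^2 - [-h_i(y_t)]_+^2) + c/2 |u - y_t|^2].
    The point y_{t+1} minimizes over Y a quadratic of curvature c + eta, so
    comparing it with u (which lies in X, hence in Y) gives an inequality in
    which the three parts of Phi telescope: the first because
    Q_{t+1} = Q_t + y_{t+1} - x_{t+1}, the second because W_{i,t+1} is the
    maximum of a linearized update and of [-h_i(y_{t+1})]_+, the third by strong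
    convexity. The quadratic terms left over are at most c/2 |y_{t+1} - y_t|^2,
    which the minimization pays for ([lyapunov_drift]).

    After taking expectations, the remaining terms of one step are controlled by
    the oracles. The subgradient s_t contributes at most f(u) - E f(y_t), plus
    L^2/(2 alpha) for its square; the linear minimization oracle contributes
    eta (delta + D^2/2); and the constraints contribute
    sum_i E (W_{i,t} + h_i(y_t)) (<g_{i,t}, u - y_t> + h_i(y_t)), which is
    nonpositive because W_{i,t} + h_i(y_t) is nonnegative and h_i(u) <= 0
    ([expected_drift]).

    Summing over t bounds sum_t (E f(y_t) - f(u)) + E Phi_T. To pass from the
    y_t to the output xbar, take a subgradient z of f at xbar, with |z| <= L:
    since Q_T = sum_t (y_t - x_t), T f(xbar) <= sum_t f(y_t) + L |Q_T|, and
    Phi_T absorbs L |Q_T| up to L^2/(2 eta) ([output_gap_le]).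

    The probabilistic part rests on one fact: a call of the oracle at y_t that is
    conditionally independent of the past given y_t has, given the whole past,
    the law K(y_t). In terms of sets, P(C, r in B) is the integral over C of
    K(y_t)(B) for every past event C ([oracle_call_rectangle]); this disintegrates
    integrals of functions of the past and of the answer
    ([ge0_disintegration], [disintegration]), which is what allows subgradients to
    be tested against weights W_{i,t} + h_i(y_t) that depend on the past
    ([conditional_subgradient_le]). All variables of a run are square integrable,
    by induction on t, although Y may be unbounded ([run_L2]). *)

(** * Inner products *)
Section Geometry.
Context {R : realType} {V : euclideanType R}.
Implicit Types u v w : V.

Lemma innerC u v : '[u, v] = '[v, u].
Proof. by rewrite hermC /= expr0 mul1r. Qed.

Lemma innerDl u v w : '[u + v, w] = '[u, w] + '[v, w].
Proof. exact: linearDl. Qed.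
Lemma innerDr u v w : '[w, u + v] = '[w, u] + '[w, v].
Proof. exact: linearD. Qed.
Lemma innerNl u v : '[- u, v] = - '[u, v].
Proof. exact: linearNl. Qed.
Lemma innerNr u v : '[u, - v] = - '[u, v].
Proof. exact: linearN. Qed.
Lemma innerBl u v w : '[u - v, w] = '[u, w] - '[v, w].
Proof. by rewrite innerDl innerNl. Qed.
Lemma innerBr u v w : '[w, u - v] = '[w, u] - '[w, v].
Proof. by rewrite innerDr innerNr. Qed.
Lemma innerZl a u v : '[a *: u, v] = a * '[u, v].
Proof. exact: linearZl_LR. Qed.
Lemma innerZr a u v : '[u, a *: v] = a * '[u, v].
Proof. exact: linearZr_LR. Qed.
Lemma inner0l v : '[0, v] = 0. Proof. exact: linear0l. Qed.
Lemma inner0r v : '[v, 0] = 0. Proof. exact: linear0. Qed.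
Lemma inner_suml (I : Type) (r : seq I) (F : I -> V) v :
  '[\sum_(i <- r) F i, v] = \sum_(i <- r) '[F i, v].
Proof.
elim: r => [|i r IH]; first by rewrite !big_nil inner0l.
by rewrite !big_cons innerDl IH.
Qed.
Lemma inner_ge0 v : 0 <= '[v, v].
Proof.
have [->|v0] := eqVneq v 0; first by rewrite inner0l.
exact/ltW/neq0_dnorm_gt0.
Qed.
Lemma normE2 v : `|v| ^+ 2 = '[v, v].
Proof. by rewrite norm_inner sqr_sqrtr ?inner_ge0. Qed.

Definition innerE := (innerDl, innerDr, innerNl, innerNr, innerZl, innerZr).

Lemma normB2 u v : `|u - v| ^+ 2 = `|u| ^+ 2 + `|v| ^+ 2 - 2 * '[u, v].
Proof. by rewrite !normE2 !innerE (innerC v u); ring. Qed.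

(** Expand the squared norm of |v| u - |u| v, which is nonnegative. *)
Lemma cauchy_schwarz u v : '[u, v] <= `|u| * `|v|.
Proof.
have [->|u0] := eqVneq u 0; first by rewrite inner0l normr0 mul0r.
have [->|v0] := eqVneq v 0; first by rewrite inner0r normr0 mulr0.
have p : 0 < `|u| * `|v| by rewrite mulr_gt0 ?normr_gt0.
have := inner_ge0 (`|v| *: u - `|u| *: v).
rewrite !innerE (innerC v u) -!normE2 => h.
rewrite -(ler_pM2l p); lra.
Qed.

Lemma cauchy_schwarz_abs u v : `|'[u, v]| <= `|u| * `|v|.
Proof.
rewrite ler_norml cauchy_schwarz andbT lerNl -innerNl.
by rewrite (le_trans (cauchy_schwarz _ _))// normrN.
Qed.

Lemma mulr_young (a x y : R) : 0 < a -> x * y <= x ^+ 2 / (2 * a) + a / 2 * y ^+ 2.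
Proof.
move=> a0; have := mulr_ge0 (ltW a0) (sqr_ge0 (x / a - y)).
have -> : a * (x / a - y) ^+ 2 =
    2 * (x ^+ 2 / (2 * a) + a / 2 * y ^+ 2) - 2 * (x * y).
  by field; rewrite gt_eqF.
by rewrite subr_ge0 ler_pM2l.
Qed.

Lemma inner_young (a : R) u v : 0 < a ->
  '[u, v] <= `|u| ^+ 2 / (2 * a) + a / 2 * `|v| ^+ 2.
Proof. by move=> a0; apply: le_trans (cauchy_schwarz _ _) (mulr_young _ _ a0). Qed.

(** Polarization reduces the claim to the continuity of the norm. *)
Lemma inner_continuous v : continuous (fun u : V => '[u, v]).
Proof.
move=> u.
rewrite (_ : (fun u => _) =
    (fun u => 2^-1 * (`|u + v| ^+ 2 - `|u| ^+ 2 - `|v| ^+ 2))); last first.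
  by apply/funext => w; rewrite !normE2 !innerE (innerC v w); field.
have c w : (fun x : V => `|x + w| ^+ 2) x @[x --> u] --> `|u + w| ^+ 2.
  rewrite expr2; under eq_fun do rewrite expr2.
  have cw : (fun x : V => `|x + w|) x @[x --> u] --> `|u + w|.
    by apply: cvg_norm; apply: cvgD; [exact: cvg_id|exact: cvg_cst].
  exact: cvgM.
have := c 0; rewrite addr0; under eq_fun do rewrite addr0; move=> c0.
apply: cvgM; first exact: cvg_cst.
by apply: cvgB; [apply: cvgB; [exact: c|exact: c0]|exact: cvg_cst].
Qed.

(** Gram-Schmidt orthogonalization, stated only through the Parseval identity:
    this is all that the coordinates are used for, and it spares the separate
    treatment of orthonormality and linear independence. *)
Lemma parseval_basis_span (l : seq V) : exists2 s : seq V,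
  {subset s <= << l >>%VS} &
  forall u v, u \in << l >>%VS -> '[u, v] = \sum_(e <- s) '[u, e] * '[v, e].
Proof.
elim: l => [|a l [s sl IH]].
  exists [::] => // u v; rewrite span_nil memv0 => /eqP ->.
  by rewrite inner0l big_nil.
pose c := \sum_(e <- s) '[a, e] *: e.
have cl : c \in << l >>%VS.
  by rewrite /c big_seq; apply: memv_suml => e es; exact/memvZ/sl.
have ac u : u \in << l >>%VS -> '[a - c, u] = 0.
  move=> ul; rewrite innerBl inner_suml (innerC a) (IH _ _ ul).
  rewrite -sumrB big1// => e _.
  by rewrite innerZl (innerC e) [_ * '[a, e]]mulrC subrr.
(* c is the projection of a on the span of l *)
have [r0|r0] := eqVneq (a - c) 0.
  have al : a \in << l >>%VS by rewrite -(subrK c a) r0 add0r.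
  have E : << a :: l >>%VS = << l >>%VS.
    by rewrite span_cons; apply/addv_idPr; rewrite -memvE.
  by exists s => [e /sl|u v]; rewrite E //; exact: IH.
pose n := `|a - c|; have n0 : 0 < n by rewrite normr_gt0.
have acl : << a :: l >>%VS = (<[a - c]> + << l >>)%VS.
  apply/eqP; rewrite span_cons eqEsubv !subv_add !addvSr !andbT.
  rewrite -!memvE; apply/andP; split.
    by rewrite -{1}(subrK c a) memv_add// memv_line.
  by rewrite memv_add ?memv_line// memvN.
exists (n^-1 *: (a - c) :: s) => [e|u v].
  rewrite inE acl => /predU1P[->|/sl el].
    by rewrite (subvP (addvSl _ _))// memvZ// memv_line.
  by rewrite (subvP (addvSr _ _)).
rewrite acl => /memv_addP[_ /vlineP[k ->] [w wl ->]].
rewrite big_cons innerDl (IH _ v wl) !innerZr !innerDl !innerZl.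
rewrite -/n -normE2 -/n (innerC w) (ac _ wl) addr0 (innerC v).
congr (_ + _).
  have : n^-1 * n = 1 by rewrite mulVf// gt_eqF.
  move: (n^-1) => i H; set x := '[a - c, v].
  have -> : i * (k * n ^+ 2) * (i * x) = (i * n) ^+ 2 * (k * x) by ring.
  by rewrite H expr1n mul1r.
apply: eq_big_seq => e es.
by rewrite !innerDl innerZl (ac e (sl _ es)) mulr0 add0r.
Qed.

Lemma exists_parseval_basis : exists s : seq V,
  forall u v, '[u, v] = \sum_(e <- s) '[u, e] * '[v, e].
Proof.
have [s _ h] := parseval_basis_span (vbasis (@fullv _ V)).
by exists s => u v; rewrite -h// (span_basis (vbasisP _)) memvf.
Qed.

Definition parseval_basis : seq V := projT1 (cid exists_parseval_basis).

Lemma parseval u v : '[u, v] = \sum_(e <- parseval_basis) '[u, e] * '[v, e].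
Proof. exact: (projT2 (cid exists_parseval_basis)). Qed.

Lemma inner_inj u v : (forall w, '[u, w] = '[v, w]) -> u = v.
Proof.
move=> uv; apply/eqP; rewrite -subr_eq0 -normr_eq0 -sqrf_eq0 normE2.
by rewrite innerBl uv subrr.
Qed.

Lemma basis_expansion u : u = \sum_(e <- parseval_basis) '[u, e] *: e.
Proof.
apply: inner_inj => w; rewrite inner_suml parseval; apply: eq_bigr => e _.
by rewrite innerZl (innerC e).
Qed.

End Geometry.

(** * Borel measurability of vector-valued maps *)
Section Borel.
Context {R : realType} {V : euclideanType R}.

Lemma continuous_borel_measurable (f : V -> R) : continuous f ->
  measurable_fun setT (f : borel V -> R).
Proof.
move=> cf; apply: (measurability _ (RGenOInfty.measurableE R)).
move=> _ [_ [r ->] <-]; rewrite setTI; apply: sub_sigma_algebra.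
by apply: open_comp => [x _|]; [exact: cf|rewrite set_itvE; exact: open_gt].
Qed.

(** Taken over a basis, these form a countable dense set, which makes every open
    set a countable union of balls. *)
Definition rational_combination (s : seq V) (c : seq rat) : V :=
  \sum_(p <- zip s c) ratr p.2 *: p.1.

Lemma rational_combination_dense (s : seq V) (a : V -> R) (e : R) : 0 < e ->
  exists c, `|\sum_(x <- s) a x *: x - rational_combination s c| < e.
Proof.
elim: s e => [|x s IH] e e0.
  by exists [::]; rewrite /rational_combination !big_nil subr0 normr0.
have [c hc] := IH (e / 2) (divr_gt0 e0 (ltr0n _ 2)).
have k0 : 0 < e / 2 / (`|x| + 1) by rewrite !divr_gt0// ltr_wpDl.
have [q] := @rat_in_itvoo R (a x - e / 2 / (`|x| + 1)) (a x)
  (ltac:(by rewrite ltrBlDr ltrDl)).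
rewrite in_itv/= => /andP[q1 q2].
exists (q :: c); rewrite /rational_combination big_cons /= big_cons /=.
rewrite opprD addrACA -scalerBl (le_lt_trans (ler_normD _ _))//.
rewrite [ltRHS]splitr ler_ltD// normrZ gtr0_norm ?subr_gt0//.
have h : a x - ratr q <= e / 2 / (`|x| + 1) by lra.
rewrite (le_trans (ler_wpM2r (normr_ge0 x) h))//.
rewrite mulrAC ler_pdivrMr ?ltr_wpDl//.
by rewrite ler_wpM2l ?lerDl// divr_ge0// ltW.
Qed.

Lemma rational_combinations_dense (u : V) (e : R) : 0 < e ->
  exists c, `|u - rational_combination parseval_basis c| < e.
Proof.
move=> e0; have [c hc] := rational_combination_dense parseval_basis
  (fun v => '[u, v]) e0.
by exists c; rewrite {1}(basis_expansion u).
Qed.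

Context {d} {T : measurableType d}.
Implicit Types X Y : T -> V.

Lemma measurable_continuous_comp (f : V -> R) X : continuous f ->
  measurable_fun setT (X : T -> borel V) -> measurable_fun setT (f \o X).
Proof.
move=> cf mX; exact: (measurableT_comp (continuous_borel_measurable cf) mX).
Qed.

Lemma measurable_innerl X v : measurable_fun setT (X : T -> borel V) ->
  measurable_fun setT (fun w => '[X w, v]).
Proof. by move=> mX; exact: (measurable_continuous_comp (@inner_continuous R V v) mX). Qed.

Lemma measurable_inner X Y : measurable_fun setT (X : T -> borel V) ->
  measurable_fun setT (Y : T -> borel V) ->
  measurable_fun setT (fun w => '[X w, Y w]).
Proof.
move=> mX mY; under eq_fun do rewrite parseval.
by apply: measurable_sum => e; apply: measurable_funM; exact: measurable_innerl.
Qed.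

Lemma measurable_norm X : measurable_fun setT (X : T -> borel V) ->
  measurable_fun setT (fun w => `|X w|).
Proof. by apply: measurable_continuous_comp => x; exact: norm_continuous. Qed.

(** Measurability can be tested on the functionals <., v>. By the Parseval
    identity the preimages of balls are then measurable, and an open set is the
    union of the balls of radius 1/(n+1) centred at rational combinations that it
    contains. This is what makes sums of measurable vector-valued maps
    measurable without comparing the Borel sets of a product with the product
    of the Borel sets. *)
Lemma borel_measurableP X : (forall v, measurable_fun setT (fun w => '[X w, v])) ->
  measurable_fun setT (X : T -> borel V).
Proof.
move=> mX.
have mball c (r : R) : measurable [set w | `|X w - c| < r].
  have [r0|r0] := leP r 0.
    rewrite (_ : mkset _ = set0) //; apply/seteqP; split => // w /= /lt_le_trans.
    by move=> /(_ _ r0); rewrite normr_lt0.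
  have mn : measurable_fun setT (fun w => `|X w - c| ^+ 2).
    under eq_fun do rewrite normE2 parseval.
    apply: measurable_sum => e; apply: measurable_funM.
      under eq_fun do rewrite innerBl.
      by apply: measurable_funB => //; exact: mX.
    under eq_fun do rewrite innerBl.
    by apply: measurable_funB => //; exact: mX.
  have -> : [set w | `|X w - c| < r] =
      setT `&` (fun w => `|X w - c| ^+ 2) @^-1` `]-oo, r ^+ 2[.
    rewrite setTI; apply/seteqP; split => w /=; rewrite in_itv/= ltr_pXn2r//;
      by rewrite nnegrE// ltW.
  exact: mn.
apply: (@measurability _ _ T (borel V) setT X (@open V) erefl) => _ [U oU <-].
rewrite setTI.
pose F (p : seq rat * nat) : set T :=
  let c := rational_combination parseval_basis p.1 in
  let r := p.2.+1%:R^-1 in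
  if `[< ball c r `<=` U >] then [set w | `|X w - c| < r] else set0.
have -> : X @^-1` U = \bigcup_p F p.
  apply/seteqP; split => w /=.
    move=> Uw; have /nbhs_ballP[e /= e0 eU] : nbhs (X w) U by exact: open_nbhs_nbhs.
    have [n hn] : exists n : nat, n.+1%:R^-1 < e / 2 :> R.
      by have := near_infty_natSinv_lt (PosNum (divr_gt0 e0 (ltr0n _ 2)));
        move=> [n _ /(_ n (leqnn n))]; exists n.
    have [c hc] := rational_combinations_dense (X w)
      (ltac:(by rewrite invr_gt0) : 0 < n.+1%:R^-1).
    exists (c, n) => //; rewrite /F/=; case: asboolP => // abs; case: abs.
    move=> x; rewrite -ball_normE /= => hx; apply: eU.
    rewrite -ball_normE /=.
    rewrite -(subrK (rational_combination parseval_basis c) (X w)) -addrA.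
    by rewrite (le_lt_trans (ler_normD _ _))// [ltRHS]splitr ltrD// (lt_trans _ hn).
  move=> [[c n] _]; rewrite /F/=; case: asboolP => // h /= hw.
  by apply: h; rewrite -ball_normE /= distrC.
apply: countable_bigcupT_measurable => // p; rewrite /F.
by case: asboolP.
Qed.

Lemma borel_measurableD X Y : measurable_fun setT (X : T -> borel V) ->
  measurable_fun setT (Y : T -> borel V) ->
  measurable_fun setT ((fun w => X w + Y w) : T -> borel V).
Proof.
move=> mX mY; apply: borel_measurableP => v; under eq_fun do rewrite innerDl.
by apply: measurable_funD; exact: measurable_innerl.
Qed.

Lemma borel_measurableZ (a : T -> R) X : measurable_fun setT a ->
  measurable_fun setT (X : T -> borel V) ->
  measurable_fun setT ((fun w => a w *: X w) : T -> borel V).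
Proof.
move=> ma mX; apply: borel_measurableP => v; under eq_fun do rewrite innerZl.
by apply: measurable_funM => //; exact: measurable_innerl.
Qed.

Lemma borel_measurableB X Y : measurable_fun setT (X : T -> borel V) ->
  measurable_fun setT (Y : T -> borel V) ->
  measurable_fun setT ((fun w => X w - Y w) : T -> borel V).
Proof.
move=> mX mY; apply: borel_measurableP => v; under eq_fun do rewrite innerBl.
by apply: measurable_funB; exact: measurable_innerl.
Qed.

Lemma borel_measurable_sum (I : Type) (r : seq I) (F : I -> T -> V) :
  (forall i, measurable_fun setT (F i : T -> borel V)) ->
  measurable_fun setT ((fun w => \sum_(i <- r) F i w) : T -> borel V).
Proof.
move=> mF; apply: borel_measurableP => v; under eq_fun do rewrite inner_suml.
by apply: measurable_sum => i; exact: measurable_innerl.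
Qed.

End Borel.

(** * The one-step inequality *)
Section Drift.
Context {R : realType} {V : euclideanType R}.
Implicit Types u v p x y : V.

Lemma convex_set_comb (Y : set V) x y (t : R) : convex_set Y -> Y x -> Y y ->
  0 <= t -> t <= 1 -> Y (t *: x + (1 - t) *: y).
Proof.
move=> cY Yx Yy t0 t1.
have := cY x y (Itv01 t0 t1) (mem_set Yx) (mem_set Yy).
by move/set_mem.
Qed.

Lemma convex_set_mean (X : set V) (x : nat -> V) n : convex_set X ->
  (forall k, (1 <= k <= n.+1)%N -> X (x k)) ->
  X (n.+1%:R^-1 *: \sum_(1 <= k < n.+2) x k).
Proof.
move=> cX; elim: n => [|n IH] Xx.
  by rewrite big_nat1 invr1 scale1r; exact: Xx.
rewrite big_nat_recr//= scalerDr.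
pose t : R := n.+1%:R / n.+2%:R.
have n2 : n.+2%:R != 0 :> R by [].
have n1 : n.+1%:R != 0 :> R by [].
have -> : n.+2%:R^-1 = t * n.+1%:R^-1 :> R by rewrite /t mulrAC divff// mul1r.
rewrite -[(t * _) *: \sum_(_ <= _ < _) _]scalerA.
have -> : t * n.+1%:R^-1 = 1 - t :> R.
  by rewrite /t mulrAC divff// mul1r -(@natr1 _ n.+1); field.
apply: convex_set_comb => //.
- by apply: IH => k /andP[k1 kn]; apply: Xx; rewrite k1 (leq_trans kn).
- by apply: Xx; rewrite /= leqnn.
- by rewrite divr_ge0.
- by rewrite ler_pdivrMr// mul1r ler_nat.
Qed.

(** Moving from p towards u by a fraction t stays in Y, so it cannot bring the
    point closer to v; the first-order term in t of the squared distance is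
    minus the inner product below. *)
Lemma projection_obtuse (Y : set V) v p u : convex_set Y ->
  is_projection Y v p -> Y u -> '[v - p, u - p] <= 0.
Proof.
move=> cY [Yp pmin] Yu; rewrite leNgt; apply/negP => a0.
set a := '[v - p, u - p] in a0; pose b := `|u - p| ^+ 2.
have b0 : 0 <= b by exact: sqr_ge0.
have ab : 0 < a + b by rewrite ltr_wpDr.
(* a step short enough for the quadratic term t b to be smaller than 2 a *)
pose t := a / (a + b).
have t0 : 0 < t by rewrite divr_gt0.
have t1 : t <= 1 by rewrite ler_pdivrMr// mul1r lerDl.
have := pmin _ (convex_set_comb cY Yu Yp (ltW t0) t1).
rewrite -ler_sqr ?nnegrE//.
have -> : v - (t *: u + (1 - t) *: p) = (v - p) - t *: (u - p).
  by rewrite scalerBl scale1r scalerBr addrCA opprD addrA.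
rewrite [leRHS]normB2 innerZr -/a normrZ exprMn real_normK ?num_real// -/b.
rewrite -addrA lerDl subr_ge0 expr2 => h0.
have h : 2 * a <= t * b by rewrite -(ler_pM2l t0); lra.
have : t * b <= a by rewrite mulrAC ler_pdivrMr// ler_pM2l// lerDr ltW.
lra.
Qed.

(** The three-point inequality of the proximal step: the point projected is the
    unconstrained minimizer of
    z |-> <p, z> + c/2 |z - y|^2 + eta/2 |z - x'|^2,
    so y' is the minimizer over Y, and the value at u is larger by at least
    (c + eta)/2 |u - y'|^2. *)
Lemma projection_prox (Y : set V) (c eta : R) u x' y y' p :
  0 < c + eta -> convex_set Y -> Y u ->
  is_projection Y ((c + eta)^-1 *: (c *: y + eta *: x' - p)) y' ->
  c / 2 * (`|y - y'| ^+ 2 + `|u - y'| ^+ 2 - `|u - y| ^+ 2)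
  + eta / 2 * (`|x' - y'| ^+ 2 + `|u - y'| ^+ 2 - `|u - x'| ^+ 2)
  <= '[p, u - y'].
Proof.
move=> c0 cY Yu /projection_obtuse/(_ Yu) => /(_ cY).
rewrite -(ler_pM2l c0) mulr0 -innerZl scalerBr scalerA divff ?gt_eqF// scale1r.
rewrite !normE2 !innerE (innerC x' y') (innerC u y') (innerC y y').
rewrite (innerC u x') (innerC u y) => h; lra.
Qed.

Lemma positive_part_sqr_le (a : R) : positive_part a ^+ 2 <= a ^+ 2.
Proof.
rewrite /positive_part; case: (leP 0 a) => // a0.
by rewrite expr0n /= sqr_ge0.
Qed.

(** The square of a maximum is at most the sum of the squares, and
    (W + h)^2 = W^2 - h^2 + 2 (W + h) h. Subtracting the square of [-h]_+ on both
    sides is what makes the bound telescope. *)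
Lemma queue_drift (W h h' c : R) :
  Num.max (W + h + c) (positive_part (- h')) ^+ 2 - positive_part (- h') ^+ 2 <=
  W ^+ 2 - positive_part (- h) ^+ 2 + 2 * ((W + h) * h) + 2 * ((W + h) * c)
  + c ^+ 2.
Proof.
have h1 := positive_part_sqr_le (- h); rewrite sqrrN in h1.
have h2 : Num.max (W + h + c) (positive_part (- h')) ^+ 2 <=
    (W + h + c) ^+ 2 + positive_part (- h') ^+ 2.
  by case: (leP (W + h + c)) => _; rewrite ?lerDl ?lerDr sqr_ge0.
move: (Num.max (W + h + c) _ ^+ 2) (positive_part (- h) ^+ 2) h1 h2.
by move: (positive_part (- h') ^+ 2) => a b w h1 h2; lra.
Qed.

Definition lyapunov {m} (eta beta c : R) (u Q y : V) (W h : 'I_m -> R) : R :=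
  eta / 2 * `|Q| ^+ 2
  + beta / 2 * (\sum_(i < m) (W i ^+ 2 - positive_part (- h i) ^+ 2))
  + c / 2 * `|u - y| ^+ 2.

(** The quadratic terms that no other term compensates are
    alpha/2 |y' - y|^2, from Young's inequality for <s, y - y'>, and
    beta/2 sum_i <g_i, y' - y>^2, which is at most beta/2 G^2 |y' - y|^2; both
    are paid for by the term c/2 |y' - y|^2 of the proximal step. *)
Lemma lyapunov_drift {m} (Y : set V) (eta alpha beta G D : R) u Q s x' y y'
    (g : 'I_m -> V) (W h h' Gi : 'I_m -> R) :
  0 < eta -> 0 < alpha -> 0 < beta -> convex_set Y -> Y u ->
  (forall i, `|g i| <= Gi i) -> \sum_(i < m) Gi i ^+ 2 <= G ^+ 2 ->
  `|u - x'| <= D ->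
  let c := alpha + 2 * G ^+ 2 * beta in
  let p := eta *: Q + s + beta *: \sum_(i < m) (W i + h i) *: g i in
  is_projection Y ((c + eta)^-1 *: (c *: y + eta *: x' - p)) y' ->
  lyapunov eta beta c u (Q + y' - x') y'
    (fun i => Num.max (W i + h i + '[g i, y' - y]) (positive_part (- h' i))) h' <=
  lyapunov eta beta c u Q y W h
  + '[s, u - y] + `|s| ^+ 2 / (2 * alpha) + eta * '[Q, u - x']
  + eta / 2 * D ^+ 2
  + beta * \sum_(i < m) (W i + h i) * ('[g i, u - y] + h i).
Proof.
move=> eta0 alpha0 beta0 cY Yu gG GiG uxD c p py'.
have G0 := sqr_ge0 G.
have c0 : 0 < c by rewrite ltr_wpDr// mulr_ge0 ?(ltW beta0)// mulr_ge0.
have prox := projection_prox (addr_gt0 c0 eta0) cY Yu py'.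
have uxD2 : `|u - x'| ^+ 2 <= D ^+ 2.
  by rewrite ler_pXn2r ?nnegrE// (le_trans (normr_ge0 _) uxD).
pose a := `|y - y'| ^+ 2; have a0 : 0 <= a by exact: sqr_ge0.
pose Sh := \sum_(i < m) (W i + h i) * h i.
pose Sg := \sum_(i < m) (W i + h i) * '[g i, y' - y].
pose Su := \sum_(i < m) (W i + h i) * '[g i, u - y].
pose P0 := \sum_(i < m) (W i ^+ 2 - positive_part (- h i) ^+ 2).
have queues : \sum_(i < m) ((Num.max (W i + h i + '[g i, y' - y])
      (positive_part (- h' i))) ^+ 2 - positive_part (- h' i) ^+ 2) <=
    P0 + 2 * Sh + 2 * Sg + G ^+ 2 * a.
  apply: (@le_trans _ _ (P0 + 2 * Sh + 2 * Sg + \sum_(i < m) Gi i ^+ 2 * a)).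
    rewrite !mulr_sumr -!big_split /=; apply: ler_sum => i _.
    apply: le_trans (queue_drift _ _ _ _) _; rewrite lerD2l.
    rewrite -[leLHS]real_normK ?num_real// /a distrC -exprMn.
    rewrite ler_pXn2r ?nnegrE ?mulr_ge0// ?(le_trans _ (gG i))//.
    by rewrite (le_trans (cauchy_schwarz_abs _ _))// ler_wpM2r.
  by rewrite lerD2l -mulr_suml ler_wpM2r.
have pE : '[p, u - y'] = eta * '[Q, u - y'] + '[s, u - y'] + beta * (Su - Sg).
  rewrite /p !innerDl !innerZl inner_suml -sumrB; congr (_ + _ * _).
  apply: eq_bigr => i _; rewrite innerZl -mulrBr -innerBr opprB addrA.
  by rewrite subrK.
have young : '[s, u - y'] <= '[s, u - y] + `|s| ^+ 2 / (2 * alpha) + alpha / 2 * a.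
  have -> : u - y' = (u - y) + (y - y') by rewrite addrA subrK.
  by rewrite innerDr -addrA lerD2l inner_young.
have QE : `|Q + y' - x'| ^+ 2 = `|Q| ^+ 2 + `|x' - y'| ^+ 2 - 2 * '[Q, x' - y'].
  by rewrite -normB2 opprB addrA.
have QE2 : '[Q, u - y'] = '[Q, u - x'] + '[Q, x' - y'].
  by rewrite -innerDr addrA subrK.
have SuE : \sum_(i < m) (W i + h i) * ('[g i, u - y] + h i) = Su + Sh.
  by rewrite -big_split; apply: eq_bigr => i _; rewrite mulrDr.
rewrite /lyapunov QE SuE -/P0 /=.
have h1 := ler_wpM2l (ltW beta0) queues.
have h2 := ler_wpM2l (ltW eta0) uxD2.
have h3 : 0 <= beta * (G ^+ 2 * a) by rewrite mulr_ge0 ?(ltW beta0)// mulr_ge0.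
move: prox; rewrite pE QE2 -/a /c => prox.
move: queues h1; set P1 := \sum_(i < m) _ => queues h1.
have h4 : 0 <= eta * `|u - y'| ^+ 2 by rewrite mulr_ge0 ?sqr_ge0// ltW.
lra.
Qed.
End Drift.

(** * Conditional laws of oracle answers *)

(** The image measure of a map that is not given as a bundled measurable
    function, with its structure of probability. *)
Definition law {d d'} {T : measurableType d} {T' : measurableType d'}
    {R : realType} (P : probability T R) (f : T -> T')
    (mf : measurable_fun setT f) : probability T' R :=
  let F : {mfun T >-> T'} :=
    HB.pack f (isMeasurableFun.Build _ _ _ _ _ mf) in
  distribution P F.

Lemma lawE {d d'} {T : measurableType d} {T' : measurableType d'}
    {R : realType} (P : probability T R) (f : T -> T')
    (mf : measurable_fun setT f) : law P mf = pushforward P f :> (set T' -> \bar R).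
Proof. by []. Qed.

Section PullOut.
Context {d} {Omega : measurableType d} {R : realType}.
Variable P : probability Omega R.
Context {dq} {TQ : measurableType dq} (q : Omega -> TQ).
Hypothesis mq : measurable_fun setT q.
Local Open Scope ereal_scope.

Import HBNNSimple.

Lemma preimage_sub_measurable (S : set TQ) : measurable S -> measurable (q @^-1` S).
Proof. by move=> mS; rewrite -[X in measurable X]setTI; exact: mq. Qed.

(** A bounded function of q can be pulled out of a conditional expectation given
    q. It is stated for D, the difference of a variable and its conditional
    expectation: the integral vanishes for indicators of events of q, hence for
    simple functions, and passes to the limit by dominated convergence. *)
Lemma pull_out (D : Omega -> R) (k : TQ -> R) :
  P.-integrable setT (EFin \o D) ->
  (forall S, measurable S -> \int[P]_(w in q @^-1` S) (D w)%:E = 0) ->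
  measurable_fun setT k -> (forall y, 0 <= k y <= 1)%R ->
  \int[P]_w (k (q w) * D w)%:E = 0.
Proof.
move=> iD D0 mk k01.
have mk' : measurable_fun setT (EFin \o k) by exact/measurable_EFinP.
have mD : measurable_fun setT D by exact/measurable_EFinP/(measurable_int _ iD).
have k0 y : setT y -> 0 <= (EFin \o k) y.
  by move=> _; rewrite lee_fin; case/andP: (k01 y).
pose f_ := nnsfun_approx measurableT mk'.
have int0 n : \int[P]_w (f_ n (q w) * D w)%:E = 0.
  have iS y : P.-integrable setT
      (fun w => (y * (\1_(f_ n @^-1` [set y]) (q w) * D w))%:E).
    under eq_fun do rewrite EFinM.
    apply: integrableZl => //.
    apply: (le_integrable _ _ _ iD) => //.
      apply/measurable_EFinP/measurable_funM => //.
      by apply: measurableT_comp => //; exact: measurable_indic.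
    move=> w _ /=; rewrite lee_fin normrM ler_piMl//.
    by rewrite indicE; case: (_ \in _); rewrite /= ?normr1 ?normr0.
  have E w : (f_ n (q w) * D w)%:E = \sum_(y <- fset_set (range (f_ n)))
      (y * (\1_(f_ n @^-1` [set y]) (q w) * D w))%:E.
    rewrite fimfunE fsbig_finite//= big_distrl /= sumEFin; congr EFin.
    by apply: eq_bigr => y _; rewrite mulrA.
  under eq_integral do rewrite E.
  rewrite integral_sum// big1// => y _.
  under eq_integral do rewrite EFinM.
  rewrite integralZl//.
    have -> : \int[P]_w (\1_(f_ n @^-1` [set y]) (q w) * D w)%:E =
        \int[P]_(w in q @^-1` (f_ n @^-1` [set y])) (D w)%:E.
      rewrite [RHS]integral_mkcond; apply: eq_integral => w _.
      rewrite patchE indicE.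
      have -> : (w \in q @^-1` (f_ n @^-1` [set y])) =
          (q w \in f_ n @^-1` [set y]) by [].
      by case: ifPn => _; rewrite ?mul1r ?mul0r.
    by rewrite D0 ?mule0.
  apply: (le_integrable _ _ _ iD) => //.
    apply/measurable_EFinP/measurable_funM => //.
    by apply: measurableT_comp => //; exact: measurable_indic.
  move=> w _ /=; rewrite lee_fin normrM ler_piMl//.
  by rewrite indicE; case: (_ \in _); rewrite /= ?normr1 ?normr0.
have [_ _] := @dominated_convergence _ _ _ P setT measurableT
  (fun n w => (f_ n (q w) * D w)%:E) (fun w => (k (q w) * D w)%:E)
  (fun w => `|(D w)%:E|)
  (fun n => ltac:(by apply/measurable_EFinP/measurable_funM => //;
                  exact: measurableT_comp))
  (ltac:(by apply/measurable_EFinP/measurable_funM => //;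
                  exact: measurableT_comp))
  (ltac:(apply: aeW => w _; under eq_fun do rewrite EFinM;
     rewrite EFinM; apply: cvgeMr => //; exact: cvg_nnsfun_approx))
  (integrable_abse iD)
  (ltac:(apply: aeW => w n _; rewrite /= lee_fin normrM ler_piMl// ger0_norm//;
    rewrite (@le_trans _ _ (k (q w)))//; first
      (rewrite -lee_fin nnsfun_approxE; exact: (le_approx n k0));
    by case/andP: (k01 (q w)))).
rewrite (_ : [sequence _]_n = cst 0); last by apply/funext => n; exact: int0.
by move=> h; apply: (cvg_unique _ h) => //; exact: cvg_cst.
Qed.

Lemma integral_EFin_eq (F G : Omega -> R) :
  P.-integrable setT (EFin \o F) -> P.-integrable setT (EFin \o G) ->
  \int[P]_w (F w - G w)%:E = 0 -> \int[P]_w (F w)%:E = \int[P]_w (G w)%:E.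
Proof.
move=> iF iG; rewrite integralB_EFin// => /eqP.
have fF := integrable_fin_num measurableT iF.
have fG := integrable_fin_num measurableT iG.
by rewrite sube_eq ?add0e ?fin_num_adde_defl// => /eqP.
Qed.

Lemma cond_exp_pull_out (X Z : Omega -> R) (k : TQ -> R) :
  is_cond_exp P (g_sigma_algebra_preimage q) X Z ->
  measurable_fun setT k -> (forall y, 0 <= k y <= 1)%R ->
  \int[P]_w (k (q w) * X w)%:E = \int[P]_w (k (q w) * Z w)%:E.
Proof.
move=> [iX iZ _ eqS] mk k01.
have mkq : measurable_fun setT (k \o q) by exact: measurableT_comp.
have ik F : P.-integrable setT (EFin \o F) ->
    P.-integrable setT (EFin \o (fun w => k (q w) * F w)%R).
  move=> iF; have mF : measurable_fun setT F by exact/measurable_EFinP/(measurable_int _ iF).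
  apply: (le_integrable _ _ _ iF) => //.
    by apply/measurable_EFinP; exact: measurable_funM.
  move=> w _ /=; rewrite lee_fin normrM ler_piMl//.
  by have /andP[k0 k1] := k01 (q w); rewrite ger0_norm.
apply: integral_EFin_eq; [exact: ik|exact: ik|].
under eq_integral do rewrite -mulrBr.
apply: (pull_out (D := fun w => (X w - Z w)%R)) => // [|S mS].
  by have := integrableB measurableT iX iZ; apply: eq_integrable.
have mS' := preimage_sub_measurable mS.
rewrite integralB_EFin//; try exact: (integrableS measurableT).
rewrite eqS ?subee//; last by exists S => //; rewrite setTI.
by apply: integrable_fin_num => //; exact: (integrableS measurableT).
Qed.

(** Both versions are measurable for the sigma-algebra of q and have the same
    integrals there, so they agree almost everywhere for the restriction of P to
    it, that is, for the image of P by the identity. *)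
Lemma cond_exp_unique (X Z Z' : Omega -> R) :
  is_cond_exp P (g_sigma_algebra_preimage q) X Z ->
  is_cond_exp P (g_sigma_algebra_preimage q) X Z' ->
  {ae P, forall w, Z w = Z' w}.
Proof.
move=> [_ iZ mZ eZ] [_ iZ' mZ' eZ'].
pose T' := g_sigma_algebra_preimageType q.
have mid : measurable_fun setT (id : Omega -> T').
  move=> _ B [S mS <-]; rewrite !setTI; exact: preimage_sub_measurable.
have mW (W : Omega -> R) : (forall B, measurable B ->
    g_sigma_algebra_preimage q (W @^-1` B)) ->
    measurable_fun setT (EFin \o (W : T' -> R)).
  by move=> h; apply/measurable_EFinP => _ B mB; rewrite setTI; exact: h.
have : ae_eq (law P mid) setT (EFin \o (Z : T' -> R))
    (EFin \o (Z' : T' -> R)).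
  apply: integral_ae_eq => //; rewrite ?lawE; [|exact: mW|move=> E _ mE].
    by apply: integrable_pushforward => //; exact: mW.
  rewrite !integral_pushforward//; try (by exact: mW);
    try (by apply: (integrableS measurableT) => //;
            rewrite -[X in measurable X]setTI; exact: mid).
  by rewrite -eZ// -eZ'.
move=> [N [mN PN sN]]; exists N; split => //.
  by rewrite -[X in measurable X]setTI; exact: (mid).
by move=> w /= h; apply: sN => /= /(_ I) [].
Qed.

End PullOut.

Section OracleCall.
Context {d} {Omega : measurableType d} {R : realType}.
Variable P : probability Omega R.
Context {dq dr} {TQ : measurableType dq} {TR : measurableType dr}.
Variables (K : R.-pker TQ ~> TR) (q : Omega -> TQ) (r : Omega -> TR).
Variable past : set (set Omega).
Local Open Scope ereal_scope.

(** An event whose indicator has a conditional expectation is measurable; this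
    is how the measurability of the variables of a run will be obtained. *)
Lemma oracle_call_past_measurable C : oracle_call P K past q r -> past C ->
  measurable C.
Proof.
move=> [_ ci] pC.
have [_ [ZB [_ [iC _ _ _] _]]] := ci setT C
  (ex_intro2 _ _ setT measurableT (setTI _)) pC.
exact/(@measurable_indicP _ _ R)/measurable_EFinP/(measurable_int _ iC).
Qed.

(** Given the past, and not only given the query, the answer has law K(q). With
    A the event that r lies in B, conditional independence expresses
    P(A, C) as the integral of E[1_A | q] E[1_C | q]; the first factor is K(q)(B),
    a function of q, so the second may be replaced by 1_C. *)
Lemma oracle_call_rectangle C B : oracle_call P K past q r ->
  measurable_fun setT q -> measurable_fun setT r -> past C -> measurable B ->
  P (C `&` r @^-1` B) = \int[P]_(w in C) K (q w) B.
Proof.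
move=> oc mq mr pC mB; have mC := oracle_call_past_measurable oc pC.
case: oc => law ci.
have mA : measurable (r @^-1` B) by exact: preimage_sub_measurable.
have K1 y : K y B <= 1.
  rewrite -(@prob_kernel _ _ _ _ _ K y).
  by apply: le_measure => //; exact: mem_set.
have Kfin y : K y B \is a fin_num.
  by rewrite ge0_fin_numE// (le_lt_trans (K1 y))// ltry.
have [ZA [ZC [cA cC [_ iAC mAC eAC]]]] := ci (r @^-1` B) C
  (ex_intro2 _ _ B mB (setTI _)) pC.
have cK := law B mB.
pose k (y : TQ) := fine (K y B).
have mk : measurable_fun setT k.
  by apply: measurableT_comp => //; exact: measurable_kernel.
have k01 y : (0 <= k y <= 1)%R.
  by rewrite fine_ge0//= -lee_fin fineK.
have sT : g_sigma_algebra_preimage q setT.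
  by exists setT => //; rewrite setTI.
rewrite setIC -(setIT (_ `&` C)) -integral_indic//; last exact: measurableI.
rewrite eAC//.
transitivity (\int[P]_w (k (q w) * ZC w)%:E).
  have mZC : measurable_fun setT ZC.
    by case: cC => _ i _ _; exact/measurable_EFinP/(measurable_int _ i).
  apply: ae_eq_integral => //.
  - exact: measurable_int iAC.
  - by apply/measurable_EFinP/measurable_funM => //; exact: measurableT_comp.
  - by apply: filterS (cond_exp_unique mq cA cK) => w -> _.
rewrite -(cond_exp_pull_out mq cC mk k01) [RHS]integral_mkcond.
apply: eq_integral => w _; rewrite patchE indicE.
by case: ifPn => _; rewrite ?mulr1 ?mulr0// /k fineK.
Qed.

End OracleCall.

(** * Disintegration *)
Section Disintegration.
Context {d d' dr} {Omega : measurableType d} {T : measurableType d'}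
  {TR : measurableType dr} {R : realType}.
Local Open Scope ereal_scope.

Section graph_kernel.
Variable k : R.-pker T ~> TR.

(** The law of (x, Y) for Y of law k(x). The argument of type unit is there
    because the composition of kernels [kcomp] makes the second kernel depend on
    the source of the first. *)
Definition graph_kernel (z : unit * T) : {measure set (T * TR) -> \bar R} :=
  measure_function_pushforward__canonical__measure_function_Measure
    (k z.2) (pair1_measurable z.2).

Lemma graph_kernelE z A : graph_kernel z A = k z.2 (xsection A z.2).
Proof. by rewrite [in RHS]xsectionE. Qed.

Let measurable_graph_kernel U : measurable U ->
  measurable_fun setT (graph_kernel ^~ U).
Proof.
move=> mU; under eq_fun do rewrite graph_kernelE.
apply: (@measurableT_comp _ _ _ _ _ _ (fun x => k x (xsection U x)) _ snd) => //.
by apply: measurable_fun_xsection_finite_kernel; exact: mem_set.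
Qed.

HB.instance Definition _ := isKernel.Build _ _ _ _ _ graph_kernel
  measurable_graph_kernel.

Let graph_kernel_prob z : graph_kernel z setT = 1.
Proof. by rewrite graph_kernelE xsectionE preimage_setT prob_kernel. Qed.

HB.instance Definition _ := Kernel_isProbability.Build _ _ _ _ _ graph_kernel
  graph_kernel_prob.
End graph_kernel.

Section kernel_precomposition.
Variables (k : R.-pker T ~> TR) (g : Omega -> T).

Definition kernel_precomp (mg : measurable_fun setT g) (w : Omega) :
  {measure set TR -> \bar R} := k (g w).

Hypothesis mg : measurable_fun setT g.

Let measurable_kernel_precomp U : measurable U ->
  measurable_fun setT (kernel_precomp mg ^~ U).
Proof.
by move=> mU; exact: (measurableT_comp (measurable_kernel k _ mU) mg).
Qed.

HB.instance Definition _ := isKernel.Build _ _ _ _ _ (kernel_precomp mg)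
  measurable_kernel_precomp.

Let kernel_precomp_prob w : kernel_precomp mg w setT = 1.
Proof. exact: prob_kernel. Qed.

HB.instance Definition _ := Kernel_isProbability.Build _ _ _ _ _
  (kernel_precomp mg) kernel_precomp_prob.
End kernel_precomposition.

Section constant_kernel.
Variable Q : probability T R.

Definition constant_kernel (_ : unit) : {measure set T -> \bar R} := Q.

Let measurable_constant_kernel U : measurable U ->
  measurable_fun setT (constant_kernel ^~ U).
Proof. by move=> mU; exact: measurable_cst. Qed.

HB.instance Definition _ := isKernel.Build _ _ _ _ _ constant_kernel
  measurable_constant_kernel.

Let constant_kernel_prob z : constant_kernel z setT = 1.
Proof. exact: probability_setT. Qed.

HB.instance Definition _ := Kernel_isProbability.Build _ _ _ _ _ constant_kernel
  constant_kernel_prob.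
End constant_kernel.

Variables (P : probability Omega R) (p : Omega -> T) (r : Omega -> TR).
Variable k : R.-pker T ~> TR.
Hypotheses (mp : measurable_fun setT p) (mr : measurable_fun setT r).
Hypothesis rect : forall A B, measurable A -> measurable B ->
  P (p @^-1` A `&` r @^-1` B) = \int[P]_(w in p @^-1` A) k (p w) B.

(** The law of (p, r) and the composition of the law of p with the graph kernel
    of k agree on rectangles by hypothesis, hence everywhere; the formula is then
    the integral against a composition of kernels. *)
Lemma ge0_disintegration (phi : T * TR -> \bar R) : measurable_fun setT phi ->
  (forall z, 0 <= phi z) ->
  \int[P]_w phi (p w, r w) = \int[P]_w \int[k (p w)]_y phi (p w, y).
Proof.
move=> mphi phi0.
(* both sides are integrals of phi, against two measures on the product *)
have mpr : measurable_fun setT (fun w => (p w, r w)).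
  exact: measurable_fun_pair.
pose Q := law P mp.
have mk : measurable_fun setT (fun x => \int[k x]_y phi (x, y)).
  exact: (measurable_fun_integral_finite_kernel phi k).
transitivity (\int[law P mpr]_z phi z).
  by rewrite lawE ge0_integral_pushforward// preimage_setT.
transitivity (\int[kcomp (constant_kernel Q) (graph_kernel k) tt]_z phi z).
  apply: eq_measure_integral => E mE _.
  pose G := [set A `*` B | A in @measurable _ T & B in @measurable _ TR].
  apply: (measure_unique G (fun _ => setT)) => //.
  - exact: measurable_prod_measurableType.
  - move=> X Y [X1 mX1 [X2 mX2 <-{X}]] [Y1 mY1 [Y2 mY2 <-{Y}]].
    exists (X1 `&` Y1); first exact: measurableI.
    by exists (X2 `&` Y2); [exact: measurableI|rewrite setXI].
  - by move=> _; exists setT => //; exists setT => //; rewrite setXTT.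
  - by rewrite bigcup_const.
  - move=> _ [A mA [B mB <-]].
    transitivity (P (p @^-1` A `&` r @^-1` B)) => //.
    rewrite rect// /kcomp.
    transitivity (\int[law P mp]_x graph_kernel k (tt, x) (A `*` B)) => //.
    have mg : measurable_fun setT (fun x => graph_kernel k (tt, x) (A `*` B)).
      apply: (measurableT_comp (measurable_kernel (graph_kernel k) _ _)) => //.
      exact: measurableX.
    rewrite lawE ge0_integral_pushforward// preimage_setT [LHS]integral_mkcond.
    apply: eq_integral => w _; rewrite patchE.
    transitivity (k (p w) (xsection (A `*` B) (p w))); last first.
      by rewrite -(graph_kernelE k (tt, p w)).
    have [pA|pA] := boolP (p w \in A).
      by rewrite in_xsectionX// ifT.
    by rewrite notin_xsectionX// measure0 ifF//; apply: negbTE.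
  - by move=> _; rewrite -ge0_fin_numE// fin_num_measure.
rewrite integral_kcomp//.
transitivity (\int[law P mp]_x \int[graph_kernel k (tt, x)]_z phi z) => //.
have E x : \int[graph_kernel k (tt, x)]_z phi z = \int[k x]_y phi (x, y).
  transitivity (\int[pushforward (k x) (pair x)]_z phi z) => //.
  rewrite ge0_integral_pushforward// ?preimage_setT//.
transitivity (\int[pushforward P p]_x \int[k x]_y phi (x, y)).
  by apply: eq_integral => x _; exact: E.
rewrite ge0_integral_pushforward// ?preimage_setT//.
by move=> x _; exact: integral_ge0.
Qed.

(** The signed version. The positive and negative parts of phi have finite
    integrals, which gives the integrability of their kernel integrals and
    allows the difference to be taken on both sides. *)
Lemma disintegration (phi : T * TR -> R) (m : Omega -> R) :
  measurable_fun setT phi ->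
  P.-integrable setT (fun w => (phi (p w, r w))%:E) ->
  (forall w, \int[k (p w)]_y (phi (p w, y))%:E = (m w)%:E) ->
  P.-integrable setT (EFin \o m) /\
  \int[P]_w (phi (p w, r w))%:E = \int[P]_w (m w)%:E.
Proof.
move=> mphi iphi mE.
have mphi' : measurable_fun setT (EFin \o phi) by exact/measurable_EFinP.
have part (f : T * TR -> \bar R) : measurable_fun setT f ->
    (forall z, 0 <= f z) -> \int[P]_w f (p w, r w) < +oo ->
    P.-integrable setT (fun w => \int[k (p w)]_y f (p w, y)).
  move=> mf f0 foo; apply/integrableP; split.
    exact: (measurableT_comp (measurable_fun_integral_finite_kernel f k _ _) mp).
  under eq_integral do rewrite gee0_abs ?integral_ge0//.
  by rewrite -ge0_disintegration.
have mpos := measurable_funepos mphi'.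
have mneg := measurable_funeneg mphi'.
have ipos : P.-integrable setT
    (fun w => \int[k (p w)]_y (EFin \o phi)^\+ (p w, y)).
  apply: part => [//|z|]; first exact: funepos_ge0.
  rewrite -[X in \int[P]_x X x]/((EFin \o phi)^\+ \o (fun w => (p w, r w))).
  by rewrite -funepos_comp; exact: integral_funepos_lt_pinfty.
have ineg : P.-integrable setT
    (fun w => \int[k (p w)]_y (EFin \o phi)^\- (p w, y)).
  apply: part => [//|z|]; first exact: funeneg_ge0.
  rewrite -[X in \int[P]_x X x]/((EFin \o phi)^\- \o (fun w => (p w, r w))).
  by rewrite -funeneg_comp; exact: integral_funeneg_lt_pinfty.
have E : EFin \o m = (fun w => \int[k (p w)]_y (EFin \o phi)^\+ (p w, y)) \-
    (fun w => \int[k (p w)]_y (EFin \o phi)^\- (p w, y)).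
  apply/funext => w; rewrite /= -mE integralE.
  by congr (_ - _); apply: eq_integral => y _; rewrite ?funeposE ?funenegE.
split; first by rewrite E; exact: integrableB.
rewrite [RHS](_ : _ = \int[P]_w (EFin \o m) w)// E integralB//.
rewrite -(ge0_disintegration mpos (fun z => funepos_ge0 _ z)).
rewrite -(ge0_disintegration mneg (fun z => funeneg_ge0 _ z)) [LHS]integralE.
by congr (_ - _); apply: eq_integral => w _; rewrite ?funeposE ?funenegE.
Qed.

End Disintegration.

(** * Integrable and square-integrable variables *)
Section AlmostSure.
Context {d} {Omega : measurableType d} {R : realType}.
Variable P : probability Omega R.
Local Open Scope ereal_scope.

Lemma integrable_addr (F H : Omega -> R) : P.-integrable setT (EFin \o F) ->
  P.-integrable setT (EFin \o H) ->
  P.-integrable setT (EFin \o (fun w => F w + H w)%R).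
Proof. by move=> iF iH; exact: (integrableD measurableT iF iH). Qed.

Lemma integrable_mulr (c : R) (F : Omega -> R) : P.-integrable setT (EFin \o F) ->
  P.-integrable setT (EFin \o (fun w => c * F w)%R).
Proof. by move=> iF; exact: (integrableZl measurableT c iF). Qed.

Lemma integrable_subr (F H : Omega -> R) : P.-integrable setT (EFin \o F) ->
  P.-integrable setT (EFin \o H) ->
  P.-integrable setT (EFin \o (fun w => F w - H w)%R).
Proof. by move=> iF iH; exact: (integrableB measurableT iF iH). Qed.

Lemma integrable_cstr (c : R) : P.-integrable setT (EFin \o cst c).
Proof. exact: finite_measure_integrable_cst. Qed.

Lemma integrable_sumr (I : Type) (s : seq I) (F : I -> Omega -> R) :
  (forall i, P.-integrable setT (EFin \o F i)) ->
  P.-integrable setT (EFin \o (fun w => \sum_(i <- s) F i w)%R).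
Proof.
move=> iF; elim: s => [|i s IH].
  by under eq_fun do rewrite big_nil; exact: integrable_cstr.
by under eq_fun do rewrite big_cons; exact: integrable_addr.
Qed.

Lemma integral_cst_probability (c : R) : \int[P]_w c%:E = c%:E.
Proof. by have := expectation_cst P c; rewrite unlock. Qed.

Lemma ae_le_integral (F H : Omega -> R) :
  P.-integrable setT (EFin \o F) -> P.-integrable setT (EFin \o H) ->
  {ae P, forall w, (F w <= H w)%R} ->
  \int[P]_w (F w)%:E <= \int[P]_w (H w)%:E.
Proof.
move=> iF iH FH.
have iHF : P.-integrable setT (EFin \o (fun w => H w - F w)%R).
  exact: integrable_subr.
have iN : P.-integrable setT (fun w => (Num.max (H w - F w) 0)%:E).
  apply: (le_integrable measurableT _ _ iHF).
    apply/measurable_EFinP; apply: measurable_maxr => //.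
    exact/measurable_EFinP/(measurable_int _ iHF).
  move=> w _ /=; rewrite lee_fin.
  by case: (leP (H w - F w)%R 0%R) => // ?; rewrite normr0.
have : 0 <= \int[P]_w (H w - F w)%:E.
  rewrite (ae_eq_integral (fun w => (Num.max (H w - F w) 0)%:E)) //.
  - by apply: integral_ge0 => w _; rewrite lee_fin le_max lexx orbT.
  - exact: measurable_int iHF.
  - exact: measurable_int iN.
  - apply: filterS FH => w h _; congr EFin; apply/esym/max_idPl.
    by rewrite subr_ge0.
by rewrite integralB_EFin// sube_ge0// integrable_fin_num.
Qed.
Local Close Scope ereal_scope.

Lemma EFin_Rintegral (F : Omega -> R) : P.-integrable setT (EFin \o F) ->
  (\int[P]_w F w)%:E = (\int[P]_w (F w)%:E)%E.
Proof. by move=> iF; rewrite fineK//; exact: integrable_fin_num. Qed.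

Lemma ae_le_Rintegral (F H : Omega -> R) :
  P.-integrable setT (EFin \o F) -> P.-integrable setT (EFin \o H) ->
  {ae P, forall w, F w <= H w} -> \int[P]_w F w <= \int[P]_w H w.
Proof.
by move=> iF iH FH; rewrite -lee_fin !EFin_Rintegral//; exact: ae_le_integral.
Qed.

Lemma Rintegral_cst_probability (c : R) : \int[P]_w c = c.
Proof. by rewrite /Rintegral integral_cst_probability. Qed.

Lemma Rintegral_sum (I : Type) (s : seq I) (F : I -> Omega -> R) :
  (forall i, P.-integrable setT (EFin \o F i)) ->
  \int[P]_w (\sum_(i <- s) F i w) = \sum_(i <- s) \int[P]_w F i w.
Proof.
move=> iF; elim: s => [|i s IH].
  by under eq_Rintegral do rewrite big_nil; rewrite Rintegral_cst_probability big_nil.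
under eq_Rintegral do rewrite big_cons.
by rewrite RintegralD//; [rewrite IH big_cons|exact: integrable_sumr].
Qed.

End AlmostSure.

Section SquareIntegrable.
Context {d} {Omega : measurableType d} {R : realType}.
Variable P : probability Omega R.
Implicit Types F H : Omega -> R.

Lemma Lfun_measurable p F : F \in Lfun P p -> measurable_fun setT F.
Proof. by move=> /sub_Lfun_mfun/set_mem. Qed.

Lemma Lfun2_of_integrable_sqr F : measurable_fun setT F ->
  (\int[P]_w (F w ^+ 2)%:E < +oo)%E -> F \in Lfun P 2%:E.
Proof.
move=> mF h; apply/andP; split; apply: mem_set => //=.
rewrite /finite_norm unlock /Lnorm poweR_lty//.
under eq_integral => w _ do
  rewrite /= powR_mulrn// real_normK ?num_real//.
exact: h.
Qed.

(** Domination is only assumed almost surely because the bound on the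
    constraint subgradients returned by the oracle holds only almost surely. *)
Lemma Lfun2_ae_le F H : measurable_fun setT F -> H \in Lfun P 2%:E ->
  {ae P, forall w, `|F w| <= `|H w|} -> F \in Lfun P 2%:E.
Proof.
move=> mF HL FH; have mH := Lfun_measurable HL.
apply: Lfun2_of_integrable_sqr => //.
have /integrableP[_] := Lfun2_integrable_sqr HL.
apply: le_lt_trans; apply: ae_ge0_le_integral => //.
- by move=> w _; rewrite lee_fin sqr_ge0.
- by apply/measurable_EFinP; exact: measurable_funX.
- by apply: measurableT_comp => //; apply/measurable_EFinP; exact: measurable_funX.
- apply: filterS FH => w h _; rewrite /= lee_fin -real_normK ?num_real//.
  by rewrite normrX ler_pXn2r// ?nnegrE.
Qed.

Lemma Lfun2_le F H : measurable_fun setT F -> H \in Lfun P 2%:E ->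
  (forall w, `|F w| <= `|H w|) -> F \in Lfun P 2%:E.
Proof. by move=> mF HL FH; apply: (Lfun2_ae_le mF HL); exact: aeW. Qed.

Lemma Lfun2_add F H : F \in Lfun P 2%:E -> H \in Lfun P 2%:E ->
  (fun w => F w + H w) \in Lfun P 2%:E.
Proof.
have p1 : (1 <= 2%:E :> \bar R)%E by rewrite lee_fin ler1n.
by move=> hF hH; exact: ((Lfun_addr_closed P p1).2 F H hF hH).
Qed.

Lemma Lfun2_scale (a : R) F : F \in Lfun P 2%:E ->
  (fun w => a * F w) \in Lfun P 2%:E.
Proof.
move=> hF; under eq_fun do rewrite mulrC.
by apply: (Lfun_scale _ _ hF); rewrite ler1n.
Qed.

Lemma Lfun2_integrable F : F \in Lfun P 2%:E -> P.-integrable setT (EFin \o F).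
Proof.
move=> hF; apply/Lfun1_integrable/Lfun_subset12 => //.
exact: fin_num_measure.
Qed.

Lemma Lfun2_integrableM F H : F \in Lfun P 2%:E -> H \in Lfun P 2%:E ->
  P.-integrable setT (fun w => (F w * H w)%:E).
Proof. by move=> hF hH; exact/Lfun1_integrable/Lfun2_mul_Lfun1. Qed.

Context {V : euclideanType R}.
Implicit Types X Y : Omega -> V.

Definition L2 X := measurable_fun setT (X : Omega -> borel V) /\
  (fun w => `|X w|) \in Lfun P 2%:E.

Lemma L2_ae_le X F : measurable_fun setT (X : Omega -> borel V) ->
  F \in Lfun P 2%:E -> {ae P, forall w, `|X w| <= `|F w|} -> L2 X.
Proof.
move=> mX hF XF; split=> //; apply: Lfun2_ae_le hF _; first exact: measurable_norm.
by apply: filterS XF => w; rewrite normr_id.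
Qed.

Lemma L2_bounded X (C : R) : measurable_fun setT (X : Omega -> borel V) ->
  (forall w, `|X w| <= C) -> L2 X.
Proof.
move=> mX XC; apply: (@L2_ae_le _ (cst C)) => //; first exact: Lfun_cst.
by apply: aeW => w; rewrite (le_trans (XC w))// ler_norm.
Qed.

Lemma L2_cst v : L2 (cst v).
Proof. by apply: (@L2_bounded _ `|v|). Qed.

Lemma L2D X Y : L2 X -> L2 Y -> L2 (fun w => X w + Y w).
Proof.
move=> [mX hX] [mY hY]; apply: L2_ae_le (Lfun2_add hX hY) _.
  exact: borel_measurableD.
by apply: aeW => w; rewrite [leRHS]ger0_norm ?addr_ge0// ler_normD.
Qed.

Lemma L2Z (a : R) X : L2 X -> L2 (fun w => a *: X w).
Proof.
move=> [mX hX]; apply: L2_ae_le (Lfun2_scale a hX) _.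
  exact: (borel_measurableZ (a := cst a)).
by apply: aeW => w; rewrite normrZ normrM normr_id.
Qed.

Lemma L2B X Y : L2 X -> L2 Y -> L2 (fun w => X w - Y w).
Proof.
move=> hX hY; rewrite (_ : (fun w => _) = (fun w => X w + (-1) *: Y w)).
  exact/L2D/L2Z.
by apply/funext => w; rewrite scaleN1r.
Qed.

Lemma L2_sum (I : Type) (s : seq I) (X : I -> Omega -> V) :
  (forall i, L2 (X i)) -> L2 (fun w => \sum_(i <- s) X i w).
Proof.
move=> hX; elim: s => [|i s IH].
  by under eq_fun do rewrite big_nil; exact: L2_cst.
by under eq_fun do rewrite big_cons; exact: L2D.
Qed.

Lemma L2_inner X Y : L2 X -> L2 Y ->
  P.-integrable setT (fun w => ('[X w, Y w])%:E).
Proof.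
move=> [mX hX] [mY hY].
apply: (le_integrable measurableT _ _ (Lfun2_integrableM hX hY)).
  exact/measurable_EFinP/measurable_inner.
move=> w _; rewrite /= lee_fin (le_trans (cauchy_schwarz_abs _ _))//.
exact: ler_norm.
Qed.

Lemma L2_sqr X : L2 X -> P.-integrable setT (fun w => (`|X w| ^+ 2)%:E).
Proof. by move=> [_]; exact: Lfun2_integrable_sqr. Qed.

End SquareIntegrable.

(** * Expectations of oracle answers *)
Section OracleExpectation.
Context {d} {Omega : measurableType d} {R : realType}.
Variable P : probability Omega R.
Context {dq dr} {TQ : measurableType dq} {TR : measurableType dr}.
Variables (K : R.-pker TQ ~> TR) (q : Omega -> TQ) (r : Omega -> TR).
Variable base : set (set Omega).
Let past := g_sigma_algebraType base.
Hypothesis call : oracle_call P K <<s base>> q r.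
Hypothesis mq : measurable_fun setT (q : past -> TQ).
Hypothesis mr : measurable_fun setT r.
Local Open Scope ereal_scope.

Lemma measurable_past : measurable_fun setT (id : Omega -> past).
Proof.
by move=> _ B mB; rewrite setTI; exact: (oracle_call_past_measurable call).
Qed.

Lemma oracle_call_query_measurable : measurable_fun setT q.
Proof. exact: (measurableT_comp mq measurable_past). Qed.

Let rect (A : set past) B : measurable A -> measurable B ->
  P (id @^-1` A `&` r @^-1` B) = \int[P]_(w in id @^-1` A) kernel_precomp K mq w B.
Proof.
move=> mA mB.
exact: (oracle_call_rectangle call oracle_call_query_measurable mr).
Qed.

Lemma oracle_call_ge0_integral (phi : past * TR -> \bar R) :
  measurable_fun setT phi -> (forall z, 0 <= phi z) ->
  \int[P]_w phi (w, r w) = \int[P]_w \int[K (q w)]_y phi (w, y).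
Proof. exact: (ge0_disintegration measurable_past mr rect). Qed.

Lemma oracle_call_integral (phi : past * TR -> R) (c : Omega -> R) :
  measurable_fun setT phi ->
  P.-integrable setT (fun w => (phi (w, r w))%:E) ->
  (forall w, \int[K (q w)]_y (phi (w, y))%:E = (c w)%:E) ->
  P.-integrable setT (EFin \o c) /\
  \int[P]_w (phi (w, r w))%:E = \int[P]_w (c w)%:E.
Proof. exact: (disintegration measurable_past mr rect). Qed.

End OracleExpectation.

Section KernelProbability.
Context {dq dr} {TQ : measurableType dq} {TR : measurableType dr} {R : realType}.
Variables (K : R.-pker TQ ~> TR) (y : TQ).

(** A probability kernel maps points to measures; this alias gives the measure
    K(y) its structure of probability. *)
Definition kernel_law : set TR -> \bar R := K y.

HB.instance Definition _ := Measure.on kernel_law.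
HB.instance Definition _ :=
  Measure_isProbability.Build _ _ _ kernel_law (@prob_kernel _ _ _ _ _ K y).
End KernelProbability.

Section MeanBounds.
Context {d} {Omega : measurableType d} {R : realType} {V : euclideanType R}.
Variable P : probability Omega R.
Implicit Types (X : Omega -> V) (z : V).

(** |z|^2 = E <X, z> <= B |z|. *)
Lemma is_mean_norm_le X z (B : R) : is_mean P X z -> 0 <= B ->
  {ae P, forall w, `|X w| <= B} -> `|z| <= B.
Proof.
move=> mz B0 XB; have [iz ez] := mz z.
have [->|z0] := eqVneq z 0; first by rewrite normr0.
have pz : 0 < `|z| by rewrite normr_gt0.
rewrite -(ler_pM2r pz) -expr2 normE2 -lee_fin -ez.
rewrite -(integral_cst_probability P).
apply: (ae_le_integral (H := cst (B * `|z|))) => //.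
  exact: integrable_cstr.
apply: filterS XB => w Xw; rewrite (le_trans (cauchy_schwarz _ _))//.
by rewrite ler_wpM2r.
Qed.

(** |z|^2 = E <X, z> <= (E |X|^2 + |z|^2) / 2. *)
Lemma is_mean_norm_sqr_le X z (B : R) : is_mean P X z ->
  measurable_fun setT (X : Omega -> borel V) ->
  (\int[P]_w (`|X w| ^+ 2)%:E <= (B ^+ 2)%:E)%E -> `|z| ^+ 2 <= B ^+ 2.
Proof.
move=> mz mX XB; have [iz ez] := mz z.
have iX2 : P.-integrable setT (EFin \o (fun w => `|X w| ^+ 2)).
  apply/integrableP; split.
    by apply/measurable_EFinP/measurable_funX; exact: measurable_norm.
  under eq_integral do rewrite /= ger0_norm ?sqr_ge0//.
  exact: le_lt_trans XB (ltry _).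
have iC := integrable_cstr P (`|z| ^+ 2).
have : ((`|z| ^+ 2)%:E <= \int[P]_w (2^-1 * (`|X w| ^+ 2 + `|z| ^+ 2))%:E)%E.
  rewrite [in leLHS]normE2 -ez; apply: ae_le_integral => //.
    exact: (integrable_mulr _ (integrable_addr iX2 iC)).
  apply: aeW => w; have := inner_young (X w) z (ltr01).
  by rewrite mulr1; lra.
under eq_integral do rewrite EFinM.
rewrite integralZl//; last exact: (integrable_addr iX2 iC).
rewrite integralD_EFin//.
have -> : (\int[P]_w (cst (`|z| ^+ 2) w)%:E = (`|z| ^+ 2)%:E)%E.
  exact: integral_cst_probability.
move=> h.
have : ((`|z| ^+ 2)%:E <= (2^-1)%:E * ((B ^+ 2)%:E + (`|z| ^+ 2)%:E))%E.
  by rewrite (le_trans h)// lee_wpmul2l ?lee_fin// leeD.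
rewrite -EFinD -EFinM lee_fin; lra.
Qed.
End MeanBounds.

Section OracleBounds.
Context {R : realType} {V : euclideanType R} {m : nat}.
Variables (f : V -> R) (h : 'I_m -> V -> R) (Y : set V) (L : R) (Gi : 'I_m -> R).
Variable K : R.-pker (borel V) ~> (borel V * m.-tuple (borel V))%type.
Hypothesis (L0 : 0 <= L) (Gi0 : forall i, 0 <= Gi i).
Hypothesis oracle : stochastic_subgradient_oracle f h Y L Gi K.

Lemma measurable_oracle_objective :
  measurable_fun setT (fun o : borel V * m.-tuple (borel V) => o.1).
Proof. exact: measurable_fst. Qed.

Lemma measurable_oracle_constraint i :
  measurable_fun setT (fun o : borel V * m.-tuple (borel V) => tnth o.2 i).
Proof. exact: (measurableT_comp (measurable_tnth i) measurable_snd). Qed.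

Lemma oracle_sqr_integral_le y : Y y ->
  (\int[K y]_o (`|o.1 : V| ^+ 2)%:E <= (L ^+ 2)%:E)%E.
Proof.
move=> Yy; have [_ _ _] := oracle Yy.
have -> : L%:E = sqrte (L ^+ 2)%:E by rewrite /= sqrtr_sqr ger0_norm.
by rewrite lee_sqrt// lee_fin sqr_ge0.
Qed.

(** The mean of a stochastic subgradient is a subgradient, and inherits its
    bound. In particular f is L-Lipschitz on Y, and likewise each h_i is
    G_i-Lipschitz on Y. *)
Lemma oracle_subgradient_le y : Y y ->
  exists2 z, subdifferential f y z & `|z| <= L.
Proof.
move=> Yy; have [[z mz dz] _ _ _] := oracle Yy; exists z => //.
rewrite -ler_sqr ?nnegrE//.
apply: (@is_mean_norm_sqr_le _ _ _ _ (kernel_law K y) (fun o => o.1)) => //.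
  exact: measurable_oracle_objective.
exact: oracle_sqr_integral_le.
Qed.

Lemma oracle_constraint_subgradient_le i y : Y y ->
  exists2 z, subdifferential (h i) y z & `|z| <= Gi i.
Proof.
move=> Yy; have [_ /(_ i)[z mz dz] /(_ i) hb _] := oracle Yy; exists z => //.
exact: (@is_mean_norm_le _ _ _ _ (kernel_law K y) (fun o => tnth o.2 i)).
Qed.

End OracleBounds.

Lemma subgradient_lipschitz {R : realType} {V : euclideanType R} (f : V -> R)
    (Y : set V) (L : R) :
  (forall y, Y y -> exists2 z, subdifferential f y z & `|z| <= L) ->
  forall a b, Y a -> Y b -> `|f a - f b| <= L * `|a - b|.
Proof.
move=> fL a b Ya Yb.
suff le_ u v : Y v -> f v - f u <= L * `|u - v|.
  by rewrite ler_norml lerNl opprB le_//= distrC le_.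
move=> /fL[z dz zL]; have := dz u => h1.
have h2 : - '[z, u - v] <= L * `|u - v|.
  rewrite -innerNr (le_trans (cauchy_schwarz _ _))// normrN.
  by rewrite ler_wpM2r.
lra.
Qed.

Section ConditionalSubgradient.
Context {d} {Omega : measurableType d} {R : realType} {V : euclideanType R}.
Variable P : probability Omega R.
Context {dr} {TR : measurableType dr}.
Variables (K : R.-pker (borel V) ~> TR) (q : Omega -> V) (r : Omega -> TR).
Variable base : set (set Omega).
Let past := g_sigma_algebraType base.
Hypothesis call : oracle_call P K <<s base>> (q : Omega -> borel V) r.
Hypothesis mq : measurable_fun setT (q : past -> borel V).
Hypothesis mr : measurable_fun setT r.

(** The stochastic subgradient psi(r), tested against a direction and a
    nonnegative weight that are determined by the past, can be replaced by its
    conditional mean, to which the subgradient inequality applies. *)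
Lemma conditional_subgradient_le (psi : TR -> V) (F : V -> R) (u : V)
    (a : Omega -> R) :
  measurable_fun setT (psi : TR -> borel V) ->
  (forall w, exists2 z, is_mean (K (q w)) psi z & subdifferential F (q w) z) ->
  measurable_fun setT (a : past -> R) -> (forall w, 0 <= a w) ->
  P.-integrable setT (EFin \o (fun w => a w * '[psi (r w), u - q w])) ->
  P.-integrable setT (EFin \o (fun w => a w * (F u - F (q w)))) ->
  (\int[P]_w (a w * '[psi (r w), u - q w])%:E <=
   \int[P]_w (a w * (F u - F (q w)))%:E)%E.
Proof.
move=> mpsi meanq ma a0 iL iR.
pose z w := sval (cid2 (meanq w)).
have mz w : is_mean (K (q w)) psi (z w) by rewrite /z; case: cid2.
have dz w : subdifferential F (q w) (z w) by rewrite /z; case: cid2.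
pose phi (x : past * TR) := a x.1 * '[psi x.2, u - q x.1].
have mphi : measurable_fun setT phi.
  apply: measurable_funM; first exact: (measurableT_comp ma measurable_fst).
  apply: measurable_inner; first exact: (measurableT_comp mpsi measurable_snd).
  apply: (borel_measurableB (X := cst u)) => //.
  exact: (measurableT_comp mq measurable_fst).
have [w|ic ->] := oracle_call_integral call mq mr mphi
    (c := fun w => a w * '[z w, u - q w]) iL.
  have [iz ez] := mz w (u - q w).
  under eq_integral do rewrite /phi /= EFinM.
  by rewrite integralZl// ez.
apply: ae_le_integral => //; apply: aeW => w; rewrite ler_wpM2l//.
by have := dz w u; lra.
Qed.

End ConditionalSubgradient.

(** * Integrability along a run *)
Section PastSpace.
Context {d} {Omega : measurableType d} {R : realType} {V : euclideanType R}.
Implicit Types S : set (Omega -> V).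

(** Omega with a smaller sigma-algebra: a variable is a function of S when it is
    measurable as a map defined on this space. *)
Definition generated_space S :=
  g_sigma_algebraType
    (\bigcup_(X in S) g_sigma_algebra_preimage (X : Omega -> borel V)).

Lemma measurable_generator S (X : Omega -> V) : S X ->
  measurable_fun setT (X : generated_space S -> borel V).
Proof.
move=> SX _ B mB; apply: sub_sigma_algebra; exists X => //.
by exists B.
Qed.

Lemma generated_space_le S S' {d'} {T' : measurableType d'} (F : Omega -> T') :
  S `<=` S' -> measurable_fun setT (F : generated_space S -> T') ->
  measurable_fun setT (F : generated_space S' -> T').
Proof.
move=> SS' mF _ B mB; have := mF measurableT B mB.
by apply: sub_sigma_algebra2; exact: bigcup_subset.
Qed.

Definition history_generators {m} (e : execution V m Omega) (t : nat) :
    set (Omega -> V) :=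
  [set X | (exists2 k, (1 <= k <= t)%N & X = xs e k \/ X = ys e k) \/
           (exists2 k, (1 <= k < t)%N & X = ss e k \/ exists i, X = gs e k i)].

Lemma history_generatorsS {m} (e : execution V m Omega) t :
  history_generators e t `<=` history_generators e t.+1.
Proof.
move=> X [[k /andP[k1 kt] h]|[k /andP[k1 kt] h]]; [left|right]; exists k => //;
  by rewrite k1 ltnW.
Qed.

End PastSpace.

(** The right-hand side of the bound on the optimality gap, with T as a real
    number. *)
Definition gap_bound {R : realType} (L G D delta eta alpha beta T : R) : R :=
  L ^+ 2 / (2 * T * eta) + eta * ((D ^+ 2 + 2 * delta) / 2)
  + L ^+ 2 / (2 * alpha) + alpha * D ^+ 2 / (2 * T)
  + G ^+ 2 * D ^+ 2 * beta / T.

Section Run.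
Context {R : realType} {V : euclideanType R} {m : nat}.
Variables (f : V -> R) (h : 'I_m -> V -> R) (X Y : set V).
Variables (D L G : R) (Gi : 'I_m -> R).
Variable K : nat -> R.-pker (borel V) ~> (borel V * m.-tuple (borel V))%type.
Variables (x1 u : V) (delta : R).
Hypothesis f_continuous : continuous f.
Hypothesis h_continuous : forall i, continuous (h i).
Hypothesis X_convex : convex_set X.
Hypothesis X_diameter : forall x y, X x -> X y -> `|x - y| <= D.
Hypotheses (Y_convex : convex_set Y) (XY : X `<=` Y).
Hypotheses (L_ge0 : 0 <= L) (Gi_ge0 : forall i, 0 <= Gi i).
Hypothesis Gi_G : \sum_(i < m) Gi i ^+ 2 <= G ^+ 2.
Hypothesis K_oracle : forall t, stochastic_subgradient_oracle f h Y L Gi (K t).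
Hypotheses (x1_X : X x1) (u_feasible : feasible h X u).

Variables (T : nat) (eta alpha beta : R).
Hypotheses (T_gt0 : (1 <= T)%N) (eta_gt0 : 0 < eta) (alpha_gt0 : 0 < alpha)
  (beta_gt0 : 0 < beta).
Context {d} {Omega : measurableType d} (P : probability Omega R).
Variable e : execution V m Omega.
Hypothesis run : is_run P h X Y x1 G K T eta alpha beta delta e.

Let Xu : X u := u_feasible.1.
Let Yu : Y u := XY Xu.

Lemma run_xs_in t w : (1 <= t <= T)%N -> X (xs e t w).
Proof.
case: t => [//|[|t]] tT; first by rewrite (init_x run).
by have [] := step_x run (t := t.+1) tT.
Qed.

Lemma run_ys_in t w : (1 <= t <= T)%N -> Y (ys e t w).
Proof.
case: t => [//|[|t]] tT; first by rewrite (init_y run); exact: XY.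
by have [] := step_y run (t := t.+1) w tT.
Qed.

Definition past t := generated_space (history_generators e t).

Lemma run_subgradient_call t : (1 <= t <= T)%N ->
  oracle_call P (K t)
    <<s \bigcup_(Z in history_generators e t)
          g_sigma_algebra_preimage (Z : Omega -> borel V) >>
    (ys e t : Omega -> borel V) (subgradient_output e t).
Proof. exact: (subgradient_call run). Qed.

(** Variables of the past are measurable because past events are. *)
Lemma run_past_measurable t {d'} {T' : measurableType d'} (F : Omega -> T') :
  (1 <= t <= T)%N -> measurable_fun setT (F : past t -> T') ->
  measurable_fun setT F.
Proof.
move=> tT mF; exact: (measurableT_comp mF (measurable_past (run_subgradient_call tT))).
Qed.

Lemma past_measurable_xs t k : (1 <= k <= t)%N ->
  measurable_fun setT (xs e k : past t -> borel V).
Proof. by move=> kt; apply: measurable_generator; left; exists k => //; left. Qed.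

Lemma past_measurable_ys t k : (1 <= k <= t)%N ->
  measurable_fun setT (ys e k : past t -> borel V).
Proof. by move=> kt; apply: measurable_generator; left; exists k => //; right. Qed.

Lemma past_measurable_gs t k i : (1 <= k < t)%N ->
  measurable_fun setT (gs e k i : past t -> borel V).
Proof.
by move=> kt; apply: measurable_generator; right; exists k => //; right; exists i.
Qed.

Lemma past_measurable_hs t k i : (1 <= k <= t)%N ->
  measurable_fun setT ((fun w => h i (ys e k w)) : past t -> R).
Proof.
move=> kt.
exact: (@measurable_continuous_comp R V _ (past t) (h i) (ys e k)
  (@h_continuous i) (past_measurable_ys kt)).
Qed.

Lemma measurable_positive_part {d'} {T' : measurableType d'} (F : T' -> R) :
  measurable_fun setT F -> measurable_fun setT (fun w => positive_part (F w)).
Proof. by move=> mF; apply: measurable_maxr. Qed.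

Lemma past_measurable_Ws t i : (1 <= t <= T)%N ->
  measurable_fun setT (Ws e t i : past t -> R).
Proof.
elim: t => [//|[_ _|t IH tT]].
  rewrite (_ : Ws e 1 i = (fun w => positive_part (- h i (ys e 1 w)))); last first.
    by apply/funext => w; rewrite (init_W run).
  apply: measurable_positive_part; apply: measurableT_comp => //.
  exact: past_measurable_hs.
have tT' : (1 <= t.+1 < T)%N by [].
rewrite (_ : Ws e t.+2 i = (fun w => Num.max (Ws e t.+1 i w + h i (ys e t.+1 w)
                 + '[gs e t.+1 i w, ys e t.+2 w - ys e t.+1 w])
              (positive_part (- h i (ys e t.+2 w))))); last first.
  by apply/funext => w; rewrite (step_W run).
apply: measurable_maxr; last first.
  apply: measurable_positive_part; apply: measurableT_comp => //.
  by apply: past_measurable_hs; rewrite /= leqnn.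
apply: measurable_funD.
  apply: measurable_funD; last by apply: past_measurable_hs; rewrite /= leqnSn.
  exact: (generated_space_le (@history_generatorsS _ _ _ _ _ e t.+1) (IH (ltnW tT))).
apply: measurable_inner; first by apply: past_measurable_gs; rewrite /= leqnn.
by apply: borel_measurableB; apply: past_measurable_ys; rewrite /= ?leqnn ?leqnSn.
Qed.

Lemma run_measurable_ys t : (1 <= t <= T)%N ->
  measurable_fun setT (ys e t : Omega -> borel V).
Proof.
move=> tT; apply: (run_past_measurable tT); apply: past_measurable_ys.
by case/andP: tT => -> _ /=.
Qed.

Lemma run_measurable_xs t : (1 <= t <= T)%N ->
  measurable_fun setT (xs e t : Omega -> borel V).
Proof.
move=> tT; apply: (run_past_measurable tT); apply: past_measurable_xs.
by case/andP: tT => -> _ /=.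
Qed.

Lemma run_measurable_ss t : (1 <= t <= T)%N ->
  measurable_fun setT (ss e t : Omega -> borel V).
Proof.
move=> tT; exact: (measurableT_comp measurable_fst (subgradient_measurable run tT)).
Qed.

Lemma run_measurable_gs t i : (1 <= t <= T)%N ->
  measurable_fun setT (gs e t i : Omega -> borel V).
Proof.
move=> tT; rewrite (_ : gs e t i = (fun w => tnth (subgradient_output e t w).2 i)).
  exact: (measurableT_comp (measurable_oracle_constraint i)
            (subgradient_measurable run tT)).
by apply/funext => w; rewrite /= tnth_mktuple.
Qed.

Lemma run_subgradient_sqr t : (1 <= t <= T)%N ->
  (\int[P]_w (`|ss e t w| ^+ 2)%:E <= (L ^+ 2)%:E)%E.
Proof.
move=> tT.
have my : measurable_fun setT (ys e t : past t -> borel V).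
  by apply: past_measurable_ys; case/andP: tT => -> _ /=.
pose phi (z : past t * (borel V * m.-tuple (borel V))%type) :=
  (`|z.2.1 : V| ^+ 2)%:E.
have mphi : measurable_fun setT phi.
  apply/measurable_EFinP/measurable_funX/measurable_norm.
  exact: (measurableT_comp measurable_fst measurable_snd).
have := oracle_call_ge0_integral (run_subgradient_call tT) my
  (subgradient_measurable run tT) mphi.
rewrite /phi /= => ->; last by move=> z; rewrite lee_fin sqr_ge0.
rewrite -(integral_cst_probability P).
apply: ge0_le_integral => //.
- by move=> w _; apply: integral_ge0 => o _; rewrite lee_fin sqr_ge0.
- pose F (o : borel V * m.-tuple (borel V)) := (`|o.1 : V| ^+ 2)%:E.
  apply: (measurableT_comp (f := fun y : borel V => \int[K t y]_o F o)%E).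
    apply: measurable_fun_integral_kernel => //.
    + by move=> U mU; exact: measurable_kernel.
    + by move=> o; rewrite lee_fin sqr_ge0.
    + apply/measurable_EFinP/measurable_funX; apply: measurable_norm.
      exact: measurable_oracle_objective.
  exact: run_measurable_ys.
- move=> w _; apply: oracle_sqr_integral_le => //.
  exact: run_ys_in.
Qed.

Lemma run_L2_ss t : (1 <= t <= T)%N -> L2 P (ss e t).
Proof.
move=> tT; have ms := run_measurable_ss tT; split => //.
apply: Lfun2_of_integrable_sqr; first exact: measurable_norm.
exact: le_lt_trans (run_subgradient_sqr tT) (ltry _).
Qed.

(** Disintegration with the whole space as past event: the answer leaves the ball
    with probability E K(y_t)(complement of the ball) = 0. *)
Lemma run_gs_le t : (1 <= t <= T)%N ->
  {ae P, forall w, forall i, `|gs e t i w| <= Gi i}.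
Proof.
move=> tT; apply: filter_forall => i.
pose B : set (borel V * m.-tuple (borel V))%type :=
  [set o | ~ (`|tnth o.2 i : V| <= Gi i)].
have mB : measurable B.
  rewrite (_ : B = setT `&` (fun o : borel V * m.-tuple (borel V) =>
      `|tnth o.2 i : V|) @^-1` `]Gi i, +oo[).
    have mn : measurable_fun setT (fun o : borel V * m.-tuple (borel V) =>
        `|tnth o.2 i : V|).
      by apply: measurable_norm; exact: measurable_oracle_constraint.
    exact: (mn measurableT _ (measurable_itv _)).
  rewrite setTI; apply/seteqP; split => o; rewrite /B /= in_itv/= andbT ltNge;
    by move=> /negP.
have my := run_measurable_ys tT.
have := oracle_call_rectangle (run_subgradient_call tT) my
  (subgradient_measurable run tT) (@measurableT _ (past t)) mB.
rewrite setTI integral0_eq; last first.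
  move=> w _; apply/negligibleP => //.
  have [_ _ /(_ i) + _] := K_oracle t (run_ys_in w tT).
  exact: negligibleS.
move=> PB; exists (subgradient_output e t @^-1` B); split => //.
  rewrite -[X in measurable X]setTI.
  exact: (subgradient_measurable run tT measurableT mB).
by move=> w /=; rewrite /B /= tnth_mktuple.
Qed.

Lemma Lfun2_lipschitz (F : V -> R) (C : R) (y : Omega -> V) :
  measurable_fun setT (F \o y) -> 0 <= C ->
  (forall w, `|F (y w) - F u| <= C * `|y w - u|) ->
  L2 P y -> (F \o y) \in Lfun P 2%:E.
Proof.
move=> mF C0 FC hy.
have [_ hyu] := L2B hy (L2_cst P u).
apply: (Lfun2_le mF (Lfun2_add (Lfun_cst P `|F u| 2) (Lfun2_scale C hyu))) => w.
rewrite [leRHS]ger0_norm ?addr_ge0 ?mulr_ge0//= -lerBlDl.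
exact: le_trans (lerB_dist _ _) (FC w).
Qed.

Lemma run_Lfun2_hs t i : (1 <= t <= T)%N -> L2 P (ys e t) ->
  (fun w => h i (ys e t w)) \in Lfun P 2%:E.
Proof.
move=> tT; apply: (@Lfun2_lipschitz (h i) (Gi i)) => // [|w].
  apply: (run_past_measurable tT); apply: past_measurable_hs.
  by case/andP: tT => -> _ /=.
apply: (@subgradient_lipschitz _ _ (h i) Y) => //; last exact: run_ys_in.
(* the oracle of any index gives the Lipschitz constant *)
by move=> y; exact: (oracle_constraint_subgradient_le Gi_ge0 (K_oracle 0)).
Qed.

Lemma run_Lfun2_fs t : (1 <= t <= T)%N -> L2 P (ys e t) ->
  (fun w => f (ys e t w)) \in Lfun P 2%:E.
Proof.
move=> tT; apply: (@Lfun2_lipschitz f L) => // [|w].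
  exact: (measurable_continuous_comp f_continuous (run_measurable_ys tT)).
apply: (@subgradient_lipschitz _ _ f Y) => //; last exact: run_ys_in.
by move=> y; exact: (oracle_subgradient_le L_ge0 (K_oracle 0)).
Qed.

Lemma positive_part_le_norm (a : R) : `|positive_part (- a)| <= `|a|.
Proof.
rewrite -ler_sqr ?nnegrE// !real_normK ?num_real// -[leRHS]sqrrN.
exact: positive_part_sqr_le.
Qed.

Lemma Lfun2_norm (F : Omega -> R) : F \in Lfun P 2%:E ->
  (fun w => `|F w|) \in Lfun P 2%:E.
Proof.
move=> hF; apply: (Lfun2_le _ hF) => [|w]; last by rewrite normr_id.
exact: (measurableT_comp (@normr_measurable R setT) (Lfun_measurable hF)).
Qed.

Lemma L2_weighted_gs t i (F : Omega -> R) : (1 <= t <= T)%N ->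
  F \in Lfun P 2%:E -> L2 P (fun w => F w *: gs e t i w).
Proof.
move=> tT hF; apply: L2_ae_le (Lfun2_scale (Gi i) hF) _.
  exact: (borel_measurableZ (Lfun_measurable hF) (run_measurable_gs i tT)).
apply: filterS (run_gs_le tT) => w /(_ i) gG.
by rewrite normrZ normrM mulrC (ger0_norm (Gi_ge0 i)) ler_wpM2r.
Qed.

Lemma Lfun2_inner_gs t i (Z : Omega -> V) : (1 <= t <= T)%N -> L2 P Z ->
  (fun w => '[gs e t i w, Z w]) \in Lfun P 2%:E.
Proof.
move=> tT [mZ hZ]; apply: Lfun2_ae_le (Lfun2_scale (Gi i) hZ) _.
  exact: (measurable_inner (run_measurable_gs i tT) mZ).
apply: filterS (run_gs_le tT) => w /(_ i) gG.
rewrite (le_trans (cauchy_schwarz_abs _ _))// [leRHS]ger0_norm ?mulr_ge0//.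
by rewrite ler_wpM2r.
Qed.

(** Since f and the h_i are Lipschitz on Y, everything grows at most linearly
    from one step to the next. *)
Lemma run_L2 t : (1 <= t <= T)%N ->
  [/\ L2 P (ys e t), L2 P (Qs e t) & forall i, Ws e t i \in Lfun P 2%:E].
Proof.
elim: t => [//|[_ tT|t IH tT]].
  split.
  - apply: (@L2_bounded _ _ _ P _ _ `|x1|); first exact: run_measurable_ys.
    by move=> w; rewrite (init_y run).
  - rewrite (_ : Qs e 1 = cst 0); first exact: L2_cst.
    by apply/funext => w; rewrite (init_Q run).
  - move=> i; rewrite (_ : Ws e 1 i = cst (positive_part (- h i x1))).
      exact: Lfun_cst.
    by apply/funext => w; rewrite (init_W run) (init_y run).
have tT1 : (1 <= t.+1 <= T)%N by exact: ltnW.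
have tT' : (1 <= t.+1 < T)%N by [].
have [hy hQ hW] := IH tT1; have hs := run_L2_ss tT1.
have hV i := Lfun2_add (hW i) (run_Lfun2_hs i tT1 hy).
have mx := run_measurable_xs tT.
have hx : L2 P (xs e t.+2).
  apply: (@L2_bounded _ _ _ P _ _ (`|u| + D)) => // w.
  rewrite -(subrK u (xs e t.+2 w)) addrC (le_trans (ler_normD _ _))//.
  by rewrite lerD2l X_diameter//; exact: run_xs_in.
have hp : L2 P (direction h eta beta e t.+1).
  apply: L2D; first by apply: L2D => //; exact: L2Z.
  by apply: L2Z; apply: L2_sum => i; exact: L2_weighted_gs.
have hyt : L2 P (ytilde h G eta alpha beta e t.+1).
  apply: L2Z; apply: L2B => //; apply: L2D; exact: L2Z.
have hy' : L2 P (ys e t.+2).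
  have [_ hd] := L2B hyt (L2_cst P u).
  have [] := L2D (X := fun w => ys e t.+2 w - u) _ (L2_cst P u).
    apply: L2_ae_le (Lfun2_scale 2 hd) _.
      by apply: (borel_measurableB (Y := cst u)) => //; exact: run_measurable_ys.
    apply: aeW => w /=; rewrite normrM (ger0_norm (ler0n _ 2)) normr_id.
    (* the projection is at least as close as u, which lies in Y *)
    have [_ /(_ u Yu) le_u] := step_y run (t := t.+1) w tT'.
    rewrite -(subrK (ytilde h G eta alpha beta e t.+1 w) (ys e t.+2 w)) -addrA.
    rewrite (le_trans (ler_normD _ _))// mulr2n mulrDl mul1r lerD2r.
    by rewrite distrC.
  under eq_fun do rewrite subrK.
  by under [X in X \in _ -> _]eq_fun do rewrite subrK; split.
split => // [|i].
  rewrite (_ : Qs e t.+2 = (fun w => Qs e t.+1 w + ys e t.+2 w - xs e t.+2 w)).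
    by apply: L2B => //; exact: L2D.
  by apply/funext => w; rewrite (step_Q run).
have hg := Lfun2_inner_gs i tT1 (L2B hy' hy).
apply: (Lfun2_le _ (Lfun2_add (Lfun2_norm (Lfun2_add (hV i) hg))
   (Lfun2_norm (run_Lfun2_hs i tT hy')))).
  by apply: (run_past_measurable tT); exact: past_measurable_Ws.
move=> w; rewrite (step_W run)// [leRHS]ger0_norm ?addr_ge0//.
have hB := positive_part_le_norm (h i (ys e t.+2 w)).
case: (leP (Ws e t.+1 i w + _ + _)) => _.
  by rewrite (le_trans hB)// lerDr.
by rewrite lerDl.
Qed.

(** * Expected drift and optimality gap *)
Let prox_weight := alpha + 2 * G ^+ 2 * beta.

Definition run_lyapunov t w : R :=
  lyapunov eta beta prox_weight u (Qs e t w) (ys e t w)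
    (fun i => Ws e t i w) (fun i => h i (ys e t w)).

Lemma run_drift t : (1 <= t < T)%N ->
  {ae P, forall w, run_lyapunov t.+1 w <= run_lyapunov t w
    + '[ss e t w, u - ys e t w] + `|ss e t w| ^+ 2 / (2 * alpha)
    + eta * '[Qs e t w, u - xs e t.+1 w] + eta / 2 * D ^+ 2
    + beta * \sum_(i < m) (Ws e t i w + h i (ys e t w))
                * ('[gs e t i w, u - ys e t w] + h i (ys e t w))}.
Proof.
move=> tT; have tT1 : (1 <= t <= T)%N by case/andP: tT => -> /ltnW.
apply: filterS (run_gs_le tT1) => w gG.
rewrite {1}/run_lyapunov (step_Q run)//.
rewrite (_ : (fun i => Ws e t.+1 i w) = fun i =>
    Num.max (Ws e t i w + h i (ys e t w) + '[gs e t i w, ys e t.+1 w - ys e t w])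
     (positive_part (- h i (ys e t.+1 w)))); last first.
  by apply/funext => i; rewrite (step_W run).
apply: (@lyapunov_drift R V m Y eta alpha beta G D u _ _ _ _ _ _ _ _ _ Gi) => //.
  by apply: X_diameter => //; apply: run_xs_in; case/andP: tT => _ ->.
exact: (step_y run).
Qed.

Lemma lyapunov_integrable t : (1 <= t <= T)%N ->
  P.-integrable setT (EFin \o run_lyapunov t).
Proof.
move=> tT; have [hy hQ hW] := run_L2 tT.
apply: integrable_addr; first apply: integrable_addr.
- by apply: integrable_mulr; exact: L2_sqr.
- apply: integrable_mulr; apply: integrable_sumr => i.
  apply: integrable_subr; first exact: Lfun2_integrable_sqr.
  apply: Lfun2_integrable_sqr.
  have hh := run_Lfun2_hs i tT hy.
  apply: (Lfun2_le _ hh) => [|w]; last exact: positive_part_le_norm.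
  apply: measurable_positive_part; apply: measurableT_comp => //.
  exact: Lfun_measurable hh.
- by apply: integrable_mulr; apply: L2_sqr; apply: L2B => //; exact: L2_cst.
Qed.

Lemma run_queue_ge t i w : (1 <= t <= T)%N ->
  positive_part (- h i (ys e t w)) <= Ws e t i w.
Proof.
case: t => [//|[_|t tT]]; first by rewrite (init_W run).
by rewrite (step_W run)// le_max lexx orbT.
Qed.

(** This is why the update of W takes a maximum with [-h_i]_+: it keeps the
    weights of the constraint subgradients nonnegative. *)
Lemma run_queue_sum_ge0 t i w : (1 <= t <= T)%N ->
  0 <= Ws e t i w + h i (ys e t w).
Proof.
move=> tT; rewrite -lerBlDr sub0r (le_trans _ (run_queue_ge i w tT))//.
by rewrite /positive_part le_max lexx orbT.
Qed.

Lemma expected_objective_gap t : (1 <= t <= T)%N ->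
  \int[P]_w '[ss e t w, u - ys e t w] <= f u - \int[P]_w f (ys e t w).
Proof.
move=> tT; have [hy _ _] := run_L2 tT.
have huy := L2B (L2_cst P u) hy.
have isy := L2_inner (run_L2_ss tT) huy.
have iF := Lfun2_integrable (run_Lfun2_fs tT hy).
have ifu := integrable_cstr P (f u).
rewrite -[X in X - _](Rintegral_cst_probability P) -RintegralB//.
rewrite -lee_fin !EFin_Rintegral//; last exact: integrable_subr.
have my : measurable_fun setT (ys e t : past t -> borel V).
  by apply: past_measurable_ys; case/andP: tT => -> _ /=.
have mul1E (F : Omega -> R) : (\int[P]_w (F w)%:E = \int[P]_w (1 * F w)%:E)%E.
  by apply: eq_integral => w _; rewrite mul1r.
have mul1I (F : Omega -> R) : P.-integrable setT (EFin \o F) ->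
    P.-integrable setT (EFin \o (fun w => 1 * F w)) by exact: integrable_mulr.
rewrite (mul1E (fun w => '[ss e t w, u - ys e t w])).
rewrite (mul1E (fun w => f u - f (ys e t w))).
apply: (@conditional_subgradient_le _ _ _ _ P _ _ _ _ _ _
  (run_subgradient_call tT) my (subgradient_measurable run tT)
  (fun o => o.1) f u (fun=> 1) measurable_oracle_objective) => //.
- by move=> w; have [] := K_oracle t (run_ys_in w tT).
- exact: mul1I.
- by apply: mul1I; exact: integrable_subr.
Qed.

(** The subgradient inequality turns <g_i, u - y_t> into h_i(u) - h_i(y_t), and
    h_i(u) <= 0 by feasibility. *)
Lemma expected_queue_gap t i : (1 <= t <= T)%N ->
  \int[P]_w ((Ws e t i w + h i (ys e t w))
             * ('[gs e t i w, u - ys e t w] + h i (ys e t w))) <= 0.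
Proof.
move=> tT; have [hy _ hW] := run_L2 tT.
have huy := L2B (L2_cst P u) hy.
have hh := run_Lfun2_hs i tT hy.
have hV := Lfun2_add (hW i) hh.
have hg := Lfun2_inner_gs i tT huy.
have iVg := Lfun2_integrableM hV hg.
have iVh := Lfun2_integrableM hV hh.
have iVu : P.-integrable setT (EFin \o (fun w =>
    (Ws e t i w + h i (ys e t w)) * (h i u - h i (ys e t w)))).
  under eq_fun do rewrite mulrBr.
  by apply: integrable_subr => //; apply: Lfun2_integrableM => //; exact: Lfun_cst.
have my : measurable_fun setT (ys e t : past t -> borel V).
  by apply: past_measurable_ys; case/andP: tT => -> _ /=.
have mV : measurable_fun setT ((fun w => Ws e t i w + h i (ys e t w)) : past t -> R).
  apply: measurable_funD; first exact: past_measurable_Ws.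
  by apply: past_measurable_hs; case/andP: tT => -> _ /=.
under eq_Rintegral do rewrite mulrDr.
rewrite RintegralD//.
have le_gap := @conditional_subgradient_le _ _ _ _ P _ _ _ _ _ _
  (run_subgradient_call tT) my (subgradient_measurable run tT)
  (fun o => tnth o.2 i) (h i) u (fun w => Ws e t i w + h i (ys e t w))
  (measurable_oracle_constraint i).
have gE w : tnth (subgradient_output e t w).2 i = gs e t i w.
  by rewrite /= tnth_mktuple.
have le_gap2 : \int[P]_w ((Ws e t i w + h i (ys e t w)) * '[gs e t i w, u - ys e t w])
    <= \int[P]_w ((Ws e t i w + h i (ys e t w)) * (h i u - h i (ys e t w))).
  rewrite -lee_fin !EFin_Rintegral//.
  rewrite (eq_integral (fun w => ((Ws e t i w + h i (ys e t w)) *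
      '[tnth (subgradient_output e t w).2 i, u - ys e t w])%:E)); last first.
    by move=> w _; rewrite gE.
  apply: le_gap => //.
  + by move=> w; have [_ /(_ i)] := K_oracle t (run_ys_in w tT).
  + by move=> w; exact: run_queue_sum_ge0.
  + by apply: eq_integrable iVg => // w _; rewrite /= tnth_mktuple.
apply: (@le_trans _ _ (\int[P]_w 0)); last by rewrite Rintegral_cst_probability.
apply: le_trans (lerD le_gap2 (lexx _)) _.
rewrite -RintegralD//; apply: le_Rintegral => //.
- exact: integrable_addr.
- exact: integrable_cstr.
- move=> w _; rewrite -mulrDr subrK mulr_ge0_le0//.
    exact: run_queue_sum_ge0.
  exact: u_feasible.2.
Qed.

(** The conditional guarantee of the oracle, integrated over the whole space. *)
Lemma expected_linear_oracle_gap t : (1 <= t < T)%N ->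
  \int[P]_w '[Qs e t w, u - xs e t.+1 w] <= delta.
Proof.
move=> tT; have tT1 : (1 <= t <= T)%N by case/andP: tT => -> /ltnW.
have [_ hQ _] := run_L2 tT1.
have [mx _ [Z [ixv iZ _ eZ] /(_ u Xu) leZ]] := step_x run tT.
have iQu := L2_inner hQ (L2_cst P u).
have iQx : P.-integrable setT (EFin \o (fun w => '[Qs e t w, xs e t.+1 w])).
  have := integrable_mulr (-1) ixv; apply: eq_integrable => // w _ /=.
  by rewrite mulN1r innerNr opprK innerC.
under eq_Rintegral do rewrite innerBr.
rewrite RintegralB// lerBlDr.
have eZ' : - (\int[P]_w '[Qs e t w, xs e t.+1 w]) = \int[P]_w Z w.
  rewrite -mulN1r -RintegralZl// /Rintegral -eZ; last first.
    by exists setT => //; rewrite setTI.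
  congr fine; apply: eq_integral => w _.
  by rewrite mulN1r innerNr innerC.
have : \int[P]_w Z w <= \int[P]_w (- '[Qs e t w, u] + delta).
  apply: ae_le_Rintegral => //.
    apply: integrable_addr; last exact: integrable_cstr.
    by have := integrable_mulr (-1) iQu; under eq_fun do rewrite mulN1r.
  by apply: filterS leZ => w; rewrite innerNr innerC.
rewrite RintegralD//; last 2 first.
- by have := integrable_mulr (-1) iQu; under eq_fun do rewrite mulN1r.
- exact: integrable_cstr.
have -> : \int[P]_w (- '[Qs e t w, u]) = - (\int[P]_w '[Qs e t w, u]).
  rewrite -mulN1r -RintegralZl//; apply: eq_Rintegral => w _.
  by rewrite mulN1r.
rewrite Rintegral_cst_probability -eZ'; lra.
Qed.

Lemma expected_drift t : (1 <= t < T)%N ->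
  \int[P]_w run_lyapunov t.+1 w + (\int[P]_w f (ys e t w) - f u) <=
  \int[P]_w run_lyapunov t w
  + (L ^+ 2 / (2 * alpha) + eta * delta + eta / 2 * D ^+ 2).
Proof.
move=> tT; have tT1 : (1 <= t <= T)%N by case/andP: tT => -> /ltnW.
have tT2 : (1 <= t.+1 <= T)%N by case/andP: tT => _ ->.
have [hy hQ hW] := run_L2 tT1.
have hs := run_L2_ss tT1.
have huy := L2B (L2_cst P u) hy.
have hx : L2 P (fun w => u - xs e t.+1 w).
  apply: (@L2_bounded _ _ _ P _ _ D).
    by apply: (borel_measurableB (X := cst u)) => //; exact: run_measurable_xs.
  by move=> w; apply: X_diameter => //; exact: run_xs_in.
have iq i : P.-integrable setT (EFin \o (fun w => (Ws e t i w + h i (ys e t w))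
    * ('[gs e t i w, u - ys e t w] + h i (ys e t w)))).
  have hh := run_Lfun2_hs i tT1 hy.
  apply: Lfun2_integrableM; first exact: Lfun2_add.
  by apply: Lfun2_add => //; exact: Lfun2_inner_gs.
have i1 := lyapunov_integrable tT1.
have i2 := L2_inner hs huy.
have i3 : P.-integrable setT (EFin \o (fun w => `|ss e t w| ^+ 2 / (2 * alpha))).
  under eq_fun do rewrite mulrC.
  by apply: integrable_mulr; exact: L2_sqr.
have i4 := integrable_mulr eta (L2_inner hQ hx).
have i5 := integrable_cstr P (eta / 2 * D ^+ 2).
have i6 := integrable_mulr beta (integrable_sumr _ iq).
have := ae_le_Rintegral (lyapunov_integrable tT2) _ (run_drift tT).
have i12 := integrable_addr i1 i2.
have i123 := integrable_addr i12 i3.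
have i1234 := integrable_addr i123 i4.
have i12345 := integrable_addr i1234 i5.
move=> /(_ (integrable_addr i12345 (i6 _))).
rewrite RintegralD// RintegralD// RintegralD// RintegralD// RintegralD//.
rewrite RintegralZl//; last exact: L2_inner.
rewrite (@RintegralZl _ _ _ P setT _ beta measurableT); last exact: integrable_sumr.
rewrite Rintegral_sum// Rintegral_cst_probability.
have -> : \int[P]_w (`|ss e t w| ^+ 2 / (2 * alpha)) =
    \int[P]_w (`|ss e t w| ^+ 2) / (2 * alpha).
  by rewrite RintegralZr//; exact: L2_sqr.
have e1 := expected_objective_gap tT1.
have e2 : eta * \int[P]_w '[Qs e t w, u - xs e t.+1 w] <= eta * delta.
  by rewrite ler_pM2l//; exact: expected_linear_oracle_gap.
have e3 : beta * \sum_(i < m) \int[P]_w ((Ws e t i w + h i (ys e t w))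
    * ('[gs e t i w, u - ys e t w] + h i (ys e t w))) <= 0.
  rewrite mulr_ge0_le0 ?(ltW beta_gt0)//.
  by apply: sumr_le0 => i _; exact: expected_queue_gap.
have e4 : \int[P]_w (`|ss e t w| ^+ 2) / (2 * alpha) <= L ^+ 2 / (2 * alpha).
  rewrite ler_pM2r ?invr_gt0 ?mulr_gt0// -lee_fin EFin_Rintegral.
    exact: run_subgradient_sqr.
  exact: L2_sqr.
move: e1 e2 e3 e4.
set s4 := \int[P]_w (`|ss e t w| ^+ 2) / (2 * alpha).
set b4 := L ^+ 2 / (2 * alpha).
lra.
Qed.

Let step_cost := L ^+ 2 / (2 * alpha) + eta * delta + eta / 2 * D ^+ 2.

Lemma diameter_ge0 : 0 <= D.
Proof. exact: le_trans (normr_ge0 _) (X_diameter Xu Xu). Qed.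

Lemma prox_weight_gt0 : 0 < prox_weight.
Proof.
by rewrite ltr_wpDr// mulr_ge0 ?(ltW beta_gt0)// mulr_ge0// sqr_ge0.
Qed.

(** At time 1 the queues vanish, so the potential reduces to
    c/2 |u - x_1|^2. *)
Lemma telescoped_drift t : (1 <= t <= T)%N ->
  \int[P]_w run_lyapunov t w
  + \sum_(1 <= k < t) (\int[P]_w f (ys e k w) - f u)
  <= prox_weight / 2 * D ^+ 2 + t.-1%:R * step_cost.
Proof.
elim: t => [//|[_ tT|t IH tT]].
  rewrite big_geq// addr0 mul0r addr0.
  rewrite -[leRHS](Rintegral_cst_probability P).
  apply: ae_le_Rintegral; [exact: lyapunov_integrable|exact: integrable_cstr|].
  apply: aeW => w; rewrite /run_lyapunov /lyapunov (init_Q run) normr0 expr0n mulr0.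
  rewrite add0r big1 ?mulr0 ?add0r => [|i _]; last by rewrite (init_W run) subrr.
  rewrite (init_y run) ler_pM2l ?divr_gt0 ?prox_weight_gt0//.
  by rewrite ler_pXn2r ?nnegrE ?diameter_ge0// X_diameter.
rewrite big_nat_recr//= -(@natr1 _ t) addrA.
have h1 := expected_drift (t := t.+1) tT.
have h2 := IH (ltnW tT).
rewrite -/step_cost in h1; move: step_cost h1 h2 => b /=; lra.
Qed.

Lemma run_Q_sum t w : (1 <= t <= T)%N ->
  Qs e t w = \sum_(1 <= k < t.+1) (ys e k w - xs e k w).
Proof.
elim: t => [//|[_ tT|t IH tT]].
  by rewrite big_nat1 (init_Q run) (init_x run) (init_y run) subrr.
by rewrite (step_Q run)// (IH (ltnW tT)) [RHS]big_nat_recr//= addrA.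
Qed.

Lemma output_in w : X (output T e w).
Proof.
rewrite /output; have TE : T = T.-1.+1 by rewrite prednK.
by rewrite TE; apply: convex_set_mean => // k kT; apply: run_xs_in; rewrite TE.
Qed.

(** Comparing f at each y_t with its tangent at the output, rather than f at the
    mean of the y_t with f at the output, makes the convexity of f and its
    Lipschitz continuity act at once. *)
Lemma output_objective_le w :
  T%:R * f (output T e w) <=
  \sum_(1 <= k < T.+1) f (ys e k w) + L * `|Qs e T w|.
Proof.
have [z dz zL] := oracle_subgradient_le L_ge0 (K_oracle 0) (XY (output_in w)).
have T0 : T%:R != 0 :> R by rewrite pnatr_eq0 -lt0n.
have xE : \sum_(1 <= k < T.+1) xs e k w = T%:R *: output T e w.
  by rewrite /output scalerA divff// scale1r.
have : \sum_(1 <= k < T.+1) (f (output T e w) + '[z, ys e k w - output T e w])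
    <= \sum_(1 <= k < T.+1) f (ys e k w).
  by apply: ler_sum => k _; exact: dz.
rewrite big_split /= big_const_nat iter_addr addr0 subn1 /= -[_ *+ T]mulr_natl.
rewrite -(big_morph _ (fun a b => innerDr a b z) (inner0r z)).
have -> : \sum_(1 <= k < T.+1) (ys e k w - output T e w) = Qs e T w.
  rewrite run_Q_sum ?leqnn ?andbT// !sumrB xE; congr (_ - _).
  by rewrite big_const_nat iter_addr addr0 subn1 /= -scaler_nat.
have := cauchy_schwarz (- z) (Qs e T w); rewrite innerNl normrN.
have := ler_wpM2r (normr_ge0 (Qs e T w)) zL.
move: (`|z| * _) (L * `|_|) => a b; lra.
Qed.

(** The potential at time T pays for L |Q_T| and for the last term
    f(y_T) - f(u), which the telescoped sum does not contain. *)
Lemma output_gap_le w :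
  T%:R * (f (output T e w) - f u) <=
  run_lyapunov T w + \sum_(1 <= k < T) (f (ys e k w) - f u)
  + (L ^+ 2 / (2 * alpha) + L ^+ 2 / (2 * eta)).
Proof.
have TT : (1 <= T <= T)%N by rewrite T_gt0 /=.
have h1 := output_objective_le w.
have h2 : f (ys e T w) - f u <= L ^+ 2 / (2 * alpha) + alpha / 2 * `|u - ys e T w| ^+ 2.
  have lip := subgradient_lipschitz
    (fun y Yy => oracle_subgradient_le L_ge0 (K_oracle 0) Yy) (run_ys_in w TT) Yu.
  apply: le_trans (ler_norm _) _; apply: le_trans lip _.
  by rewrite distrC; exact: mulr_young.
have h3 := mulr_young L `|Qs e T w| eta_gt0.
have Psi0 : 0 <= \sum_(i < m) (Ws e T i w ^+ 2 - positive_part (- h i (ys e T w)) ^+ 2).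
  apply: sumr_ge0 => i _; rewrite subr_ge0.
  have p0 : 0 <= positive_part (- h i (ys e T w)).
    by rewrite /positive_part le_max lexx.
  have := run_queue_ge i w TT => pW.
  by rewrite ler_pXn2r ?nnegrE// (le_trans p0).
have h4 : eta / 2 * `|Qs e T w| ^+ 2 + alpha / 2 * `|u - ys e T w| ^+ 2 <=
    run_lyapunov T w.
  rewrite /run_lyapunov /lyapunov lerD//.
    by rewrite lerDl mulr_ge0// divr_ge0// ltW.
  rewrite ler_wpM2r ?sqr_ge0// ler_pM2r// lerDl mulr_ge0 ?(ltW beta_gt0)//.
  by rewrite mulr_ge0// sqr_ge0.
have h5 : \sum_(1 <= k < T.+1) f (ys e k w) =
    \sum_(1 <= k < T) (f (ys e k w) - f u) + (f (ys e T w) - f u) + T%:R * f u.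
  rewrite -(big_nat_recr T 1 (fun k => f (ys e k w) - f u))//= sumrB.
  rewrite big_const_nat iter_addr addr0 subn1 /= -[_ *+ T]mulr_natl.
  by rewrite subrK.
move: h1; rewrite h5; move: h2 h3 h4.
set lyap := run_lyapunov T w.
move: (L ^+ 2 / (2 * alpha)) (L ^+ 2 / (2 * eta)) => a b; lra.
Qed.

Lemma output_measurable : measurable_fun setT (output T e : Omega -> borel V).
Proof.
apply: (borel_measurableZ (a := cst T%:R^-1)) => //.
under eq_fun do rewrite big_add1 /= big_mkord.
apply: borel_measurable_sum => i; apply: run_measurable_xs.
by rewrite /= ltn_ord.
Qed.

Lemma output_objective_integrable : P.-integrable setT
  (EFin \o (fun w => f (output T e w))).
Proof.
apply: Lfun2_integrable.
have mo := output_measurable.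
apply: (@Lfun2_lipschitz f L) => // [|w|].
- exact: (measurable_continuous_comp f_continuous mo).
- apply: (@subgradient_lipschitz _ _ f Y) => //; last exact: XY (output_in w).
  by move=> y; exact: (oracle_subgradient_le L_ge0 (K_oracle 0)).
- apply: (@L2_bounded _ _ _ P _ _ (`|u| + D)) => // w.
  rewrite -(subrK u (output T e w)) addrC (le_trans (ler_normD _ _))//.
  by rewrite lerD2l X_diameter//; exact: output_in.
Qed.

Hypothesis delta_ge0 : 0 <= delta.

Lemma expected_gap_le :
  \int[P]_w f (output T e w) - f u <=
  gap_bound L G D delta eta alpha beta T%:R.
Proof.
have TT : (1 <= T <= T)%N by rewrite T_gt0 /=.
have T0 : 0 < T%:R :> R by rewrite ltr0n.
have iy (k : 'I_T.-1) : P.-integrable setT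
    (EFin \o (fun w => f (ys e k.+1 w) - f u)).
  have kT : (1 <= k.+1 <= T)%N.
    by rewrite /= (leq_trans (ltn_ord k))// leq_pred.
  apply: integrable_subr; last exact: integrable_cstr.
  by have [hy _ _] := run_L2 kT; exact/Lfun2_integrable/run_Lfun2_fs.
have iout : P.-integrable setT (EFin \o (fun w => f (output T e w) - f u)).
  by apply: integrable_subr; [exact: output_objective_integrable|exact: integrable_cstr].
have ilyap := lyapunov_integrable TT.
have isum := integrable_sumr (index_enum 'I_T.-1) iy.
have telescoped := telescoped_drift TT.
have gap : T%:R * (\int[P]_w f (output T e w) - f u) <=
    \int[P]_w run_lyapunov T w + \sum_(1 <= k < T) (\int[P]_w f (ys e k w) - f u)
    + (L ^+ 2 / (2 * alpha) + L ^+ 2 / (2 * eta)).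
  rewrite -[X in _ - X](Rintegral_cst_probability P) -RintegralB//; last 2 first.
  - exact: output_objective_integrable.
  - exact: integrable_cstr.
  rewrite -RintegralZl//.
  rewrite -[X in _ <= _ + X](Rintegral_cst_probability P).
  rewrite big_add1 big_mkord.
  rewrite (eq_bigr (fun k : 'I_T.-1 => \int[P]_w (f (ys e k.+1 w) - f u))).
    rewrite -Rintegral_sum// -RintegralD// -RintegralD//; last 2 first.
    - exact: integrable_addr.
    - exact: integrable_cstr.
    apply: ae_le_Rintegral; first exact: integrable_mulr.
      apply: integrable_addr; last exact: integrable_cstr.
      exact: integrable_addr.
    by apply: aeW => w; have := output_gap_le w; rewrite big_add1 big_mkord.
  move=> k _; have kT : (1 <= k.+1 <= T)%N.
    by rewrite /= (leq_trans (ltn_ord k))// leq_pred.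
  rewrite RintegralB ?Rintegral_cst_probability//; last exact: integrable_cstr.
  by have [hy _ _] := run_L2 kT; exact/Lfun2_integrable/run_Lfun2_fs.
rewrite -(ler_pM2l T0); apply: le_trans gap _.
have -> : T%:R * gap_bound L G D delta eta alpha beta T%:R =
    prox_weight / 2 * D ^+ 2 + T%:R * step_cost + L ^+ 2 / (2 * eta).
  by rewrite /gap_bound /prox_weight /step_cost; field; rewrite !gt_eqF.
have TE : T%:R = T.-1%:R + 1 :> R by rewrite natr1 prednK.
have cost : L ^+ 2 / (2 * alpha) <= step_cost.
  have e0 := ltW eta_gt0.
  rewrite /step_cost -addrA lerDl; apply: addr_ge0; first exact: mulr_ge0.
  by rewrite mulr_ge0 ?sqr_ge0// divr_ge0.
rewrite TE.
move: telescoped cost; move: (prox_weight / 2 * D ^+ 2) (L ^+ 2 / (2 * alpha)).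
move: step_cost (L ^+ 2 / (2 * eta)) => s b cD a.
by lra.
Qed.

End Run.

(** * Choice of the constants *)
Lemma optimal_valueE {R : realType} {V : euclideanType R} {m : nat}
    (f : V -> R) (h : 'I_m -> V -> R) (X : set V) (x : V) :
  optimal_solutions f h X x -> optimal_value f h X = f x.
Proof.
move=> [xF xmin]; apply/eqP; rewrite eq_le; apply/andP; split.
  apply: ge_inf; last by exists x.
  by exists (f x) => _ [z zF <-]; exact: xmin.
by apply: lb_le_inf; [exists (f x), x|move=> _ [z zF <-]; exact: xmin].
Qed.

(** Every term is at most a constant times eps or 1 / (T eps), and
    1 / (T eps) <= eps. *)
Lemma gap_bound_order {R : realType} (L G D delta eps T : R) :
  0 < eps -> 1 / eps ^+ 2 <= T ->
  gap_bound L G D delta eps (1 / eps) (1 / eps) T <=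
  (L ^+ 2 + (D ^+ 2 + 2 * delta) / 2 + D ^+ 2 / 2 + G ^+ 2 * D ^+ 2) * eps.
Proof.
move=> e0 eT; have T0 : 0 < T by rewrite (lt_le_trans _ eT)// divr_gt0 ?exprn_gt0.
pose x := (T * eps)^-1.
have xe : x <= eps.
  rewrite /x invf_ple ?posrE ?mulr_gt0// -ler_pdivrMr// -invfM -expr2.
  by rewrite -[leLHS]mul1r.
have -> : gap_bound L G D delta eps (1 / eps) (1 / eps) T =
    L ^+ 2 / 2 * x + ((D ^+ 2 + 2 * delta) / 2 + L ^+ 2 / 2) * eps
    + D ^+ 2 / 2 * x + G ^+ 2 * D ^+ 2 * x.
  by rewrite /gap_bound /x; field; rewrite !gt_eqF.
have h1 : L ^+ 2 / 2 * x <= L ^+ 2 / 2 * eps.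
  by rewrite ler_wpM2l// divr_ge0 ?sqr_ge0.
have h2 : D ^+ 2 / 2 * x <= D ^+ 2 / 2 * eps.
  by rewrite ler_wpM2l// divr_ge0 ?sqr_ge0.
have h3 : G ^+ 2 * D ^+ 2 * x <= G ^+ 2 * D ^+ 2 * eps.
  by rewrite ler_wpM2l// mulr_ge0 ?sqr_ge0.
lra.
Qed.

Lemma gap_bound_tuned {R : realType} (L G D delta T : R) :
  0 < L -> 0 < G -> 0 < D -> 0 <= delta -> 0 < T ->
  gap_bound L G D delta (L / Num.sqrt (T * (D ^+ 2 + 2 * delta)))
    (L * Num.sqrt T / D) (Num.sqrt T / (G * D)) T =
  (L * Num.sqrt (D ^+ 2 + 2 * delta) + L * D + G * D) * (1 / Num.sqrt T).
Proof.
move=> L0 G0 D0 delta0 T0.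
have r0 : 0 < D ^+ 2 + 2 * delta by rewrite ltr_wpDr ?mulr_ge0// exprn_gt0.
rewrite /gap_bound sqrtrM ?ltW//.
set s := Num.sqrt T; set r := Num.sqrt (D ^+ 2 + 2 * delta).
have s0 : 0 < s by rewrite sqrtr_gt0.
have rr0 : 0 < r by rewrite sqrtr_gt0.
have -> : D ^+ 2 + 2 * delta = r ^+ 2 by rewrite sqr_sqrtr// ltW.
have -> : T = s ^+ 2 by rewrite sqr_sqrtr// ltW.
by field; rewrite !gt_eqF.
Qed.
Theorem theorem1 (R : realType) (V : euclideanType R) (m : nat)
  (f : V -> R) (h : 'I_m -> V -> R) (X Y : set V)
  (D L G : R) (Gi : 'I_m -> R)
  (K : nat -> R.-pker (borel V) ~> (borel V * m.-tuple (borel V))%type)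
  (x1 xstar : V) (delta : R)
  (f_convex : convex_function (setT : set V) f)
  (f_continuous : continuous f)
  (h_convex : forall i, convex_function (setT : set V) (h i))
  (h_continuous : forall i, continuous (h i))
  (X_compact : compact X) (X_convex : convex_set X)
  (X_diameter : forall x y, X x -> X y -> `|x - y| <= D)
  (multiplier : exists mu, lagrange_multiplier f h X mu)
  (Y_closed : closed Y) (Y_convex : convex_set Y) (XY : X `<=` Y)
  (L_ge0 : 0 <= L) (G_ge0 : 0 <= G) (Gi_ge0 : forall i, 0 <= Gi i)
  (Gi_G : \sum_(i < m) Gi i ^+ 2 <= G ^+ 2)
  (K_oracle : forall t, stochastic_subgradient_oracle f h Y L Gi (K t))
  (x1_X : X x1) (xstar_optimal : optimal_solutions f h X xstar)
  (delta_ge0 : 0 <= delta) :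
  [/\ forall (T : nat) (eta alpha beta : R),
        (1 <= T)%N -> 0 < eta -> 0 < alpha -> 0 < beta ->
        forall (d : measure_display) (Omega : measurableType d)
          (P : probability Omega R) (e : execution V m Omega),
        is_run P h X Y x1 G K T eta alpha beta delta e ->
        ('E_P[fun w => f (output T e w)] - (f xstar)%:E <=
         (L ^+ 2 / (2 * T%:R * eta) + eta * ((D ^+ 2 + 2 * delta) / 2)
          + L ^+ 2 / (2 * alpha) + alpha * D ^+ 2 / (2 * T%:R)
          + G ^+ 2 * D ^+ 2 * beta / T%:R)%:E)%E,
      exists C : R, forall (eps : R) (T : nat),
        0 < eps -> 1 / eps ^+ 2 <= T%:R ->
        forall (d : measure_display) (Omega : measurableType d)
          (P : probability Omega R) (e : execution V m Omega),
        is_run P h X Y x1 G K T eps (1 / eps) (1 / eps) delta e ->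
        ('E_P[fun w => f (output T e w)] - (optimal_value f h X)%:E <=
         (C * eps)%:E)%E &
      0 < L -> 0 < G -> 0 < D -> forall T : nat, (1 <= T)%N ->
        forall (d : measure_display) (Omega : measurableType d)
          (P : probability Omega R) (e : execution V m Omega),
        is_run P h X Y x1 G K T
          (L / Num.sqrt (T%:R * (D ^+ 2 + 2 * delta)))
          (L * Num.sqrt T%:R / D)
          (Num.sqrt T%:R / (G * D)) delta e ->
        ('E_P[fun w => f (output T e w)] - (optimal_value f h X)%:E <=
         ((L * Num.sqrt (D ^+ 2 + 2 * delta) + L * D + G * D)
          * (1 / Num.sqrt T%:R))%:E)%E].
Proof.
have bound (T : nat) (eta alpha beta : R) : (1 <= T)%N -> 0 < eta -> 0 < alpha ->
    0 < beta -> forall (d : measure_display) (Omega : measurableType d)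
      (P : probability Omega R) (e : execution V m Omega),
    is_run P h X Y x1 G K T eta alpha beta delta e ->
    ('E_P[fun w => f (output T e w)] - (f xstar)%:E <=
      (gap_bound L G D delta eta alpha beta T%:R)%:E)%E.
  move=> T0 eta0 alpha0 beta0 d Omega P e run.
  have [xF _] := xstar_optimal.
  rewrite unlock -EFin_Rintegral.
    rewrite -EFinB lee_fin.
    exact: (expected_gap_le f_continuous h_continuous X_convex X_diameter Y_convex
      XY L_ge0 Gi_ge0 Gi_G K_oracle x1_X xF T0 eta0 alpha0 beta0 run delta_ge0).
  exact: (output_objective_integrable f_continuous X_convex X_diameter XY L_ge0
    K_oracle x1_X xF T0 run).
have D0 : 0 <= D by exact: le_trans (normr_ge0 _) (X_diameter _ _ x1_X x1_X).
split.
- exact: bound.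
- exists (L ^+ 2 + (D ^+ 2 + 2 * delta) / 2 + D ^+ 2 / 2 + G ^+ 2 * D ^+ 2).
  move=> eps T eps0 epsT d Omega P e run; rewrite (optimal_valueE xstar_optimal).
  have T0 : (1 <= T)%N.
    by rewrite -(ltr0n R) (lt_le_trans _ epsT)// divr_gt0 ?exprn_gt0.
  have ie : 0 < 1 / eps by rewrite divr_gt0.
  apply: le_trans (bound _ _ _ _ T0 eps0 ie ie _ _ _ _ run) _.
  by rewrite lee_fin; exact: gap_bound_order.
- move=> L0 G0 D1 T T0 d Omega P e run; rewrite (optimal_valueE xstar_optimal).
  have TR0 : 0 < T%:R :> R by rewrite ltr0n.
  have r0 : 0 < D ^+ 2 + 2 * delta by rewrite ltr_wpDr ?mulr_ge0// exprn_gt0.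
  have s0 : 0 < Num.sqrt T%:R :> R by rewrite sqrtr_gt0.
  rewrite -(gap_bound_tuned L0 G0 D1 delta_ge0 TR0).
  apply: bound run => //.
  + by rewrite divr_gt0// sqrtr_gt0 mulr_gt0.
  + by rewrite divr_gt0// mulr_gt0.
  + by rewrite divr_gt0// mulr_gt0.
Qed.
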